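(* For every positive integer $n$, $$4\sum_{\eta\in\mathcal W_n^*}\hat p_n(\eta)=Q_{01}(A_n)\,R_n^2\,\exp\left\{2\,m(\mathcal J_{A_n})\right\}.$$
   Context: Identify $\mathbb Z^2=\mathbb Z+i\mathbb Z\subset\mathbb C$. For each positive integer $n$ let $A_n=\{j+ik\in\mathbb Z+i\mathbb Z: -n<j<n+1,\ -n<k<n\}$. Paths and loop-erased measure. A nearest neighbor path is a finite sequence $\omega=[\omega_0,\ldots,\omega_k]$ of points of $\mathbb Z^2$ with $|\omega_j-\omega_{j-1}|=1$ for $1\le j\le k$. Write $|\omega|=k$ and $p(\omega)=4^{-|\omega|}$. Let $\mathcal K_n$ be the set of nearest neighbor paths $\omega=[\omega_0,\ldots,\omega_k]$ with $\mathrm{Re}[\omega_0]=-n$, $\mathrm{Re}[\omega_k]=n+1$ and $\{\omega_1,\ldots,\omega_{k-1}\}\subset A_n$. Let $\mathcal W_n$ be the set of $\eta\in\mathcal K_n$ that are self-avoiding (all vertices distinct). The chronological loop-erasure $L(\omega)$ of $\omega=[\omega_0,\ldots,\omega_k]$ is: $s_0=\max\{j:\omega_j=\omega_0\}$ and, as long as $s_i<k$, $s_{i+1}=\max\{j:\omega_j=\omega_{s_i+1}\}$; if $s_r=k$, then $L(\omega)=[\omega_{s_0},\ldots,\omega_{s_r}]$. For $\eta\in\mathcal W_n$ put $\hat p_n(\eta)=\sum_{\omega\in\mathcal K_n,\,L(\omega)=\eta}p(\omega)$. Let $\mathcal W_n^*$ be the set of $\eta\in\mathcal W_n$ that contain the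 directed edge $[0,1]$ or the directed edge $[1,0]$. The quantity $R_n$. Let $\mathcal K_n'$ be the set of nearest neighbor paths $\omega=[\omega_0,\ldots,\omega_k]$ with $\mathrm{Re}[\omega_0]=-n$, $\omega_k=0$ and $\{\omega_1,\ldots,\omega_{k-1}\}\subset A_n\setminus[0,\infty)$, and set $R_n=\sum_{\omega\in\mathcal K_n'}p(\omega)$. Loop measure. A rooted loop is a nearest neighbor path $l=[l_0,l_1,\ldots,l_{2k}]$ with $l_0=l_{2k}$. An unrooted loop $\bar l$ is an equivalence class of rooted loops with $k>0$ under $[l_0,l_1,\ldots,l_{2k}]\sim[l_j,l_{j+1},\ldots,l_{2k},l_1,\ldots,l_j]$ for all $j$ (orientation is retained). The random walk loop measure is $m(\bar l)=4^{-|\bar l|}\,d(\bar l)/|\bar l|$, where $|\bar l|=2k$ is the number of steps and $d(\bar l)$ is the number of distinct rooted loops in the class $\bar l$; $m$ of a set of unrooted loops is the sum of $m(\bar l)$ over the set. Write $\bar l\subset A$ if all vertices of $\bar l$ lie in $A$, and $\bar l\cap V$ for the set of vertices in $V$ visited by $\bar l$. For a path or loop $\omega$, let $J(\omega)$ be the number of times $\omega$ crosses, in either direction, an edge between $-ki$ and $-ki+1$ with $k$ a positive integer; for loops, $J$ depends only on the unrooted loop. Let $\mathcal J_A$ be the set of unrooted loops $\bar l\subset A$ such that $J(\bar l)$ is odd. Finally, $$Q_{01}(A_n)=\exp\left\{\sum_{\bar l\subset A_n,\ \bar l\cap\{0,1\}\ne\emptyset}m(\bar l)\,(-1)^{J(\bar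 l)}\right\}.$$ *)

(* Defs.v *)
From HB Require Import structures.
From mathcomp Require Import all_boot all_order all_algebra generic_quotient.
From mathcomp Require Import finmap.
From mathcomp Require Import mathcomp_extra boolp classical_sets functions.
From mathcomp Require Import cardinality reals ereal numfun esum exp.

Set Implicit Arguments.
Unset Strict Implicit.
Unset Printing Implicit Defensive.

Import Order.TTheory GRing.Theory Num.Theory.

Local Open Scope classical_set_scope.
Local Open Scope ring_scope.

(* The Gaussian integer x + iy is the pair (x, y).  Beware that the generic
   constant 1 of the product ring int * int is (1, 1), hence [pt1] below. *)
Notation Z2 := (int * int)%type.

Definition Re (x : Z2) : int := x.1.
Definition Im (x : Z2) : int := x.2.
Definition pt0 : Z2 := (0, 0).
Definition pt1 : Z2 := (1, 0).

(* |x - y| = 1, in terms of the squared modulus. *)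
Definition adj : rel Z2 :=
  fun x y => (Re x - Re y) ^+ 2 + (Im x - Im y) ^+ 2 == 1.

Definition box (n : nat) : pred Z2 := fun x =>
  (- n%:Z < Re x < n%:Z + 1) && (- n%:Z < Im x < n%:Z).

Definition half_line : pred Z2 := fun x => (0 <= Re x) && (Im x == 0).

Definition nnpath (w : seq Z2) : bool := (w != [::]) && sorted adj w.

Definition start (w : seq Z2) : Z2 := head pt0 w.
Definition finish (w : seq Z2) : Z2 := last pt0 w.

(* The number of steps: [w_0, ..., w_k] has k steps and k + 1 vertices. *)
Definition steps (w : seq Z2) : nat := (size w).-1.

(* [w_1, ..., w_(k-1)] *)
Definition inner (w : seq Z2) : seq Z2 := take (steps w).-1 (behead w).

Definition weight (R : realType) (w : seq Z2) : R := 4^-1 ^+ steps w.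

Definition pathK (n : nat) (w : seq Z2) : bool :=
  [&& nnpath w, Re (start w) == - n%:Z, Re (finish w) == n%:Z + 1
    & all (box n) (inner w)].

Definition pathW (n : nat) (eta : seq Z2) : bool := pathK n eta && uniq eta.

Definition pathWstar (n : nat) (eta : seq Z2) : bool :=
  pathW n eta && (infix [:: pt0; pt1] eta || infix [:: pt1; pt0] eta).

Definition pathK' (n : nat) (w : seq Z2) : bool :=
  [&& nnpath w, Re (start w) == - n%:Z, finish w == pt0
    & all (fun x => box n x && ~~ half_line x) (inner w)].

Section LoopErasure.
Variable w : seq Z2.

(* max {j : w_j = x} *)
Definition last_visit (x : Z2) : nat :=
  (\max_(j < size w | nth pt0 w j == x) j)%N.

(* The times s_0, s_1, ...; values after the first i with s_i = k are
   irrelevant. *)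
Fixpoint erasure_time (i : nat) : nat :=
  if i is i'.+1 then last_visit (nth pt0 w (erasure_time i').+1)
  else last_visit (nth pt0 w 0).

(* The first r with s_r = k; since (s_i) increases strictly until it reaches
   k, such an r occurs among 0, ..., k. *)
Definition erasure_steps : nat :=
  index (steps w) (mkseq erasure_time (size w)).

Definition loop_erasure : seq Z2 :=
  mkseq (fun i => nth pt0 w (erasure_time i)) erasure_steps.+1.

End LoopErasure.

Definition phat (R : realType) (n : nat) (eta : seq Z2) : \bar R :=
  \esum_(w in [set w | pathK n w /\ loop_erasure w = eta]) (weight R w)%:E.

Definition Rn (R : realType) (n : nat) : \bar R :=
  \esum_(w in [set w | pathK' n w]) (weight R w)%:E.

Definition is_loop (l : seq Z2) : bool :=
  [&& nnpath l, start l == finish l, ~~ odd (steps l) & (0 < steps l)%N].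

Record rooted_loop := RootedLoop { loop_seq :> seq Z2 ; _ : is_loop loop_seq }.
HB.instance Definition _ := [isSub for loop_seq].
HB.instance Definition _ := [Choice of rooted_loop by <:].

(* [l_0, ..., l_(2k)] |-> [l_j, ..., l_(2k), l_1, ..., l_j] *)
Definition reroot (j : nat) (l : seq Z2) : seq Z2 :=
  drop j l ++ take j (behead l).

Definition loop_equiv : rel rooted_loop := fun l l' =>
  has (fun j => loop_seq l' == reroot j l) (iota 0 (steps l).+1).

Lemma reroot_closed (x : Z2) (p : seq Z2) (j : nat) :
  (j <= size p)%N -> x = last x p ->
  reroot j (x :: p) = last x (rot j p) :: rot j p.
Proof.
case: j => [|j] jp xp; first by rewrite /reroot take0 drop0 cats0 rot0 -xp.
rewrite /reroot /= (drop_nth x jp) /rot last_cat (take_nth x jp) last_rcons.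
by [].
Qed.

Lemma loop_equivP (l l' : rooted_loop) :
  reflect (exists2 j, (j <= size (behead l))%N & behead l' = rot j (behead l))
          (loop_equiv l l').
Proof.
case: l l' => -[|x p] // lP [[|y q] // l'P].
have xp : x = last x p by case/and4P: lP => _ /eqP.
have yq : y = last y q by case/and4P: l'P => _ /eqP.
apply: (iffP hasP) => [[j]|[j jp qE]].
  rewrite mem_iota leq0n add0n ltnS /= => jp.
  by rewrite reroot_closed// => /eqP[_ ->]; exists j.
exists j; first by rewrite mem_iota leq0n add0n ltnS.
have {}qE : q = rot j p := qE.
have q0 : q != [::] by case: (q) l'P => //; rewrite /is_loop !andbF.
rewrite /= reroot_closed// -qE eqseq_cons eqxx andbT [X in X == _]yq.
by case: (q) q0.
Qed.

Lemma loop_equiv_is_equiv : equiv_class_of loop_equiv.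
Proof.
have tr : transitive loop_equiv.
  move=> l2 l1 l3 /loop_equivP[i il E2] /loop_equivP[j]; rewrite E2 size_rot.
  move=> jl E3; apply/loop_equivP.
  exists (if (i + j <= size (behead l1))%N then i + j else
          i + j - size (behead l1))%N; last by rewrite E3 rot_add_mod // addnC.
  case: ifP => // _; rewrite leq_subLR; exact: leq_add.
split=> // [l|l l'].
  by apply/loop_equivP; exists 0%N; rewrite ?rot0.
have sy m m' : loop_equiv m m' -> loop_equiv m' m.
  move=> /loop_equivP[j jm E]; apply/loop_equivP.
  exists (size (behead m) - j)%N; rewrite E ?size_rot ?leq_subr//.
  by rewrite -[LHS](rotK j) /rotr size_rot.
by apply/idP/idP; exact: sy.
Qed.

Canonical loop_equiv_rel : equiv_rel rooted_loop :=
  EquivRelPack loop_equiv_is_equiv.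

Definition unrooted_loop : Type := {eq_quot loop_equiv_rel}%qT.
HB.instance Definition _ := Choice.on unrooted_loop.
HB.instance Definition _ := EqQuotient.on unrooted_loop.

(* The functions of an unrooted loop below are read off an arbitrary
   representative: the steps, the set of vertices and the crossing number do
   not depend on the root. *)
Definition loop_repr (l : unrooted_loop) : seq Z2 := loop_seq (repr l).

Definition loop_steps (l : unrooted_loop) : nat := steps (loop_repr l).

Definition loop_sub (A : pred Z2) (l : unrooted_loop) : bool :=
  all A (loop_repr l).

Definition loop_meets (V : pred Z2) (l : unrooted_loop) : bool :=
  has V (loop_repr l).

(* The class is a finite set, so [fset_set] does enumerate it. *)
Definition loop_mult (l : unrooted_loop) : nat :=
  #|` fset_set [set r : rooted_loop | \pi_unrooted_loop r = l]%qT |.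

Definition loop_weight (R : realType) (l : unrooted_loop) : R :=
  4^-1 ^+ loop_steps l * (loop_mult l)%:R / (loop_steps l)%:R.

Definition loop_measure (R : realType) (S : set unrooted_loop) : \bar R :=
  \esum_(l in S) (loop_weight R l)%:E.

(* The step from x to y crosses an edge between -ki and -ki + 1, k > 0. *)
Definition crosses (x y : Z2) : bool :=
  [&& Im x == Im y, Im x < 0
    & (Re x == 0) && (Re y == 1) || (Re x == 1) && (Re y == 0)].

Definition crossings (w : seq Z2) : nat :=
  count (fun e => crosses e.1 e.2) (zip w (behead w)).

Definition loop_crossings (l : unrooted_loop) : nat := crossings (loop_repr l).

Definition oddJ (A : pred Z2) : set unrooted_loop :=
  [set l | loop_sub A l /\ odd (loop_crossings l)].

(* [esum] is only meaningful for nonnegative families, so a signed sum is the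
   difference of the sums of the positive and negative parts. *)
Definition signed_esum (R : realType) (T : choiceType) (D : set T)
    (f : T -> \bar R) : \bar R :=
  (\esum_(t in D) f^\+ t - \esum_(t in D) f^\- t)%E.

Definition loops01 (A : pred Z2) : set unrooted_loop :=
  [set l | loop_sub A l /\ loop_meets (pred2 pt0 pt1) l].

Definition signed_loop_weight (R : realType) (l : unrooted_loop) : \bar R :=
  (loop_weight R l * (-1) ^+ loop_crossings l)%:E.

Definition Q01 (R : realType) (A : pred Z2) : \bar R :=
  expeR (signed_esum (loops01 A) (@signed_loop_weight R)).

(* Main.v *)
From mathcomp Require Import -(notations) complex.
Require Import Defs.
From mathcomp Require Import all_boot all_order all_algebra generic_quotient finmap.
From mathcomp Require Import spectral ring lra zify.
From mathcomp Require Import mathcomp_extra boolp classical_sets functions.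
From mathcomp Require Import cardinality fsbigop reals ereal topology normedtype.
From mathcomp Require Import sequences derive realfun numfun exp esum.

Set Implicit Arguments.
Unset Strict Implicit.
Unset Printing Implicit Defensive.

Import Order.TTheory GRing.Theory Num.Theory numFieldNormedType.Exports.
Import Defs.


(** Index the vertices of the box [A_n] by a finite type and let [P] be the
    transition matrix of simple random walk killed outside the box, and [Q] the
    same matrix with a minus sign on the steps across the zipper, the edges
    between [-ki] and [-ki + 1] for [k > 0].  For a set [D] of vertices write
    [det_P D] and [det_Q D] for the determinants of [1 - P] and [1 - Q]
    restricted to [D] ([lap_det]).  Each quantity in the identity is computed
    from these determinants and from Green function sums.

    Loops.  Since [P] and [Q] are symmetric with spectral radius below one,
    [- ln (det_P D)] is the sum over [k > 0] of the traces of [P_D^k / k]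
    ([subcritical_det]), which is the total mass of the loop measure on [D];
    with [Q] each loop is counted with the sign [(-1)^J].  Adding and
    subtracting the two selects a parity of [J] ([loops_sum]).  Hence
    [2 m(J_A) = ln (det_Q A) - ln (det_P A)], and [Q_01] is the quotient of
    [det_Q] off [{0, 1}] by [det_Q A].

    Loop erasure.  Cutting a walk at its last visits to the vertices of its
    loop erasure [eta] leaves one loop at each vertex, in the complement of the
    preceding vertices.  The loops at [x] in [D] sum to
    [det_P (D \ x) / det_P D], so the product telescopes and the walks that
    erase to [eta] weigh [p(eta) det_P (A \ eta) / det_P A] ([phat_eq]).

    Topology.  Suppose that [eta] joins the two vertical sides through the
    edge [01].  A closed walk that avoids [eta] crosses the zipper an even
    number of times, because the face parity of the walk is constant along
    [eta] and vanishes on the left side ([loop_even]); thus [det_P] and [det_Q]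
    agree on [A \ eta] ([lap_det_signed]).  Following the faces on the right of
    [eta] from the left side shows that [eta] itself crosses the zipper evenly
    if it uses [0 -> 1] and oddly if it uses [1 -> 0] ([crossing_parity01],
    [crossing_parity10]).  Reversing the first half of [eta] gives a pair of
    disjoint self-avoiding paths from [0] and [1], and the sum over
    [W_n^*] becomes a sum over such pairs of signed [Q]-weights times [det_Q]
    of the complement, where exchanging the two exit sides changes the sign.

    Fomin's identity ([fomin]) turns this antisymmetrised sum into [det_Q] off
    [{0, 1}] times a two by two determinant of exit sums.  Reflection in the
    real axis acts on [Q] off [{0, 1}] by a gauge transformation, which
    forces the off-diagonal entries to vanish ([exit_sum_right0],
    [exit_sum_left1]) and makes the signed sum to the left side vanish on the
    ray [x >= 2].  A walk from [0] to the left may therefore be stopped on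
    that ray; in the slit box the signs are a gauge, so the entry is the
    unsigned sum [R_n] ([exit_sum_left0], [Rn_eq]), and the reflection
    [x -> 1 - x] identifies the other diagonal entry with it
    ([exit_sum_right1]).  The two sides of the identity are then both
    [R_n^2] times [det_Q] off [{0, 1}] over [det_P A]. *)

Local Open Scope ring_scope.

(** * Green functions, loop-erased expansion and Fomin's identity *)
Section Killed.
Variables (K : fieldType) (N : nat) (Q : 'M[K]_N).
Implicit Types (D : {set 'I_N}) (c d : 'I_N -> K) (x y b : 'I_N) (s t : seq 'I_N).

Definition killed D : 'M[K]_N :=
  \matrix_(i, j) (if (i \in D) && (j \in D) then Q i j else 0).

Definition lap_det D : K := \det (1%:M - killed D).

Definition green D : 'M[K]_N := invmx (1%:M - killed D).

(** When [Q] is subcritical this is the total weight of the walks in [D] that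
    start at [x], where a walk ending at [y] gets the extra factor [c y]. *)
Definition hit_sum D c x : K := \sum_(y in D) green D x y * c y.

(** The analogue of [hit_sum] for a starting vertex that need not belong to
    [D], while every later vertex does. *)
Definition exit_sum D c b : K := c b + \sum_(y in D) Q b y * hit_sum D c y.

Fixpoint path_weight x s : K := if s is y :: s' then Q x y * path_weight y s' else 1.

Hypothesis lap_det_neq0 : forall D, lap_det D != 0.

Let lap_unit D : (1%:M - killed D) \in unitmx.
Proof. by rewrite unitmxE unitfE lap_det_neq0. Qed.

Lemma killed_sum D x (u : 'I_N -> K) :
  \sum_y killed D x y * u y =
  if x \in D then \sum_(y in D) Q x y * u y else 0.
Proof.
case: ifPn => xD; last by rewrite big1 // => y _; rewrite mxE (negbTE xD) mul0r.
rewrite [RHS]big_mkcond; apply: eq_bigr => y _; rewrite mxE xD /=.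
by case: ifP; rewrite ?mul0r.
Qed.

Lemma hit_sum_eq D c x : x \in D -> hit_sum D c x = exit_sum D c x.
Proof.
move=> xD; pose cc := \col_y (if y \in D then c y else 0).
have hE y : (green D *m cc) y ord0 = hit_sum D c y.
  rewrite mxE /hit_sum [RHS]big_mkcond; apply: eq_bigr => z _.
  by rewrite [cc z _]mxE; case: ifP; rewrite ?mulr0.
have := mulKVmx (lap_unit D) cc; rewrite -/(green D) mulmxBl mul1mx.
move=> /matrixP/(_ x ord0); rewrite mxE hE mxE mxE.
under eq_bigr do rewrite hE.
by rewrite killed_sum [cc x _]mxE xD /exit_sum => <-; rewrite subrK.
Qed.

(** The equation is a linear system with matrix [1 - killed D], which is
    invertible: identities between walk sums follow from their one-step
    recursions. *)
Lemma hit_sum_uniq D c (u : 'I_N -> K) :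
  {in D, forall x, u x = c x + \sum_(y in D) Q x y * u y} ->
  {in D, forall x, u x = hit_sum D c x}.
Proof.
move=> uE x xD.
pose cc := \col_y (if y \in D then u y - hit_sum D c y else 0).
suff c0 : cc = 0.
  have /matrixP/(_ x ord0) := c0; rewrite !mxE xD => /eqP.
  by rewrite subr_eq0 => /eqP.
apply: (can_inj (mulKmx (lap_unit D))); rewrite mulmx0.
apply/matrixP => y z; rewrite mulmxBl mul1mx !mxE.
under eq_bigr do rewrite [cc _ _]mxE.
rewrite killed_sum; case: ifPn => yD; last by rewrite subr0.
rewrite uE // hit_sum_eq // /exit_sum opprD addrACA subrr add0r -sumrB -sumrB.
by apply: big1 => w wD; rewrite wD mulrBr subrr.
Qed.

Lemma hit_sumDZ D c d a x :
  hit_sum D (fun y => c y + a * d y) x = hit_sum D c x + a * hit_sum D d x.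
Proof.
rewrite /hit_sum mulr_sumr -big_split; apply: eq_bigr => y _ /=.
by rewrite mulrDr mulrCA.
Qed.

(** Cramer's rule: the diagonal cofactor at [x] is the same determinant for
    the walk that is killed at [x] as well. *)
Lemma green_diag D x : x \in D -> green D x x = lap_det (D :\ x) / lap_det D.
Proof.
move=> xD; rewrite /green /invmx lap_unit mxE mxE -/(lap_det D).
rewrite mulrC; congr (_ / _); rewrite /lap_det (expand_det_row _ x).
rewrite (bigD1 x) //= big1 ?addr0; last first.
  move=> y yx; rewrite !mxE in_setD1 eqxx /= subr0 eq_sym (negbTE yx).
  by rewrite mul0r.
rewrite !mxE in_setD1 !eqxx /= subr0 mul1r /cofactor.
congr (_ * \det _); apply/matrixP => i j; rewrite !mxE !in_setD1.
have nl k : (lift x k != x) by rewrite eq_sym neq_lift.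
by rewrite !nl.
Qed.

(** Either the walk from [y] avoids [x], or it reaches [x] for a first time
    and continues freely from there. *)
Lemma hit_sum_split D c x y : x \in D -> y \in D :\ x ->
  hit_sum D c y = hit_sum (D :\ x) c y + hit_sum D c x * hit_sum (D :\ x) (Q^~ x) y.
Proof.
move=> xD yD; rewrite -hit_sumDZ; apply/hit_sum_uniq: yD => z.
rewrite in_setD1 => /andP[zx zD]; rewrite hit_sum_eq // /exit_sum (bigD1 x) //=.
rewrite -addrA [hit_sum D c x * _]mulrC; congr (_ + (_ + _)).
by apply: eq_bigl => w; rewrite in_setD1 andbC.
Qed.

Lemma exit_sum_split D c x b : x \in D ->
  exit_sum D c b = exit_sum (D :\ x) c b + hit_sum D c x * exit_sum (D :\ x) (Q^~ x) b.
Proof.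
move=> xD; rewrite /exit_sum (big_setD1 x) //= mulrDr.
rewrite [hit_sum D c x * \sum_(_ in _) _]mulr_sumr addrACA [hit_sum D c x *
  _]mulrC -big_split /= addrA.
congr (_ + _); apply: eq_bigr => y yD.
by rewrite (hit_sum_split c xD yD) mulrDr mulrCA.
Qed.

(** A walk from [x] consists of loops at [x] up to the last visit, of total
    weight [lap_det (D :\ x) / lap_det D], and of a walk that never returns. *)
Lemma hit_sum_last_visit D c x : x \in D ->
  hit_sum D c x * lap_det D = lap_det (D :\ x) * exit_sum (D :\ x) c x.
Proof.
move=> xD.
pose f := exit_sum (D :\ x) (Q^~ x) x.
have first e : hit_sum D e x * (1 - f) = exit_sum (D :\ x) e x.
  by rewrite mulrBr mulr1 {1}hit_sum_eq // (exit_sum_split _ _ xD) addrK.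
have := first (fun y => (y == x)%:R).
have -> : exit_sum (D :\ x) (fun y => (y == x)%:R) x = 1.
  rewrite /exit_sum eqxx big1 ?addr0 // => y _; rewrite /hit_sum big1 ?mulr0 // => z.
  by rewrite in_setD1 => /andP[/negbTE->]; rewrite mulr0.
have -> : hit_sum D (fun y => (y == x)%:R) x = green D x x.
  rewrite /hit_sum (bigD1 x) //= eqxx mulr1 big1 ?addr0 // => y /andP[_ /negbTE->].
  by rewrite mulr0.
rewrite green_diag // => f1.
have : lap_det (D :\ x) * (1 - f) = lap_det D.
  by have := congr1 ( *%R (lap_det D)) f1; rewrite mulr1 => <-; field.
by move=> <-; rewrite mulrCA first.
Qed.

Definition avoid D s : {set 'I_N} := [set y in D | y \notin s].

(** The recursion is on [m], an upper bound for the cardinal of [D]; the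
    unfolding equation [uniq_seqsE] no longer mentions it. *)
Fixpoint uniq_seqs_rec m D : seq (seq 'I_N) :=
  [::] :: if m is m'.+1 then
    flatten [seq [seq y :: s | s <- uniq_seqs_rec m' (D :\ y)] | y <- enum D]
  else [::].

Definition uniq_seqs D := uniq_seqs_rec #|D| D.

Lemma uniq_seqsE D :
  uniq_seqs D = [::] :: flatten [seq [seq y :: s | s <- uniq_seqs (D :\ y)] | y <- enum D].
Proof.
rewrite /uniq_seqs; case Dm: #|D| => [|m] /=.
  by have /cards0_eq -> := Dm; rewrite enum_set0.
congr (_ :: flatten _); apply/eq_in_map => y; rewrite mem_enum => yD.
by move: Dm; rewrite (cardsD1 y) yD add1n => -[->].
Qed.

Lemma sum_uniq_seqs D (F : seq 'I_N -> K) :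
  \sum_(s <- uniq_seqs D) F s =
  F [::] + \sum_(y in D) \sum_(s <- uniq_seqs (D :\ y)) F (y :: s).
Proof.
rewrite uniq_seqsE big_cons big_flatten /= big_map big_enum; congr (_ + _).
by apply: eq_bigr => y _; rewrite big_map.
Qed.

Lemma mem_uniq_seqs D s : (s \in uniq_seqs D) = uniq s && all (mem D) s.
Proof.
elim: s D => [|x s IH] D; first by rewrite uniq_seqsE.
rewrite uniq_seqsE in_cons /=; apply/flattenP/idP.
  move=> [? /mapP[y]]; rewrite mem_enum => yD -> /mapP[s' s'D [xy ss']].
  move: yD s'D; rewrite -xy -ss' IH => -> /andP[-> /allP sD].
  rewrite (_ : x \notin s) /=; last first.
    by apply/negP => /sD; rewrite /= in_setD1 eqxx.
  by apply/allP => z /sD; rewrite /= in_setD1 => /andP[].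
case/andP => /andP[xs us] /andP[xD sD].
exists [seq x :: s' | s' <- uniq_seqs (D :\ x)].
  by apply/mapP; exists x; rewrite ?mem_enum.
apply/mapP; exists s => //; rewrite IH us /=; apply/allP => z zs /=.
by rewrite in_setD1 [z \in D](allP sD z zs) andbT; apply: contraNneq xs => <-.
Qed.

Lemma uniq_uniq_seqs D : uniq (uniq_seqs D).
Proof.
have [m] := ubnP #|D|; elim: m D => // m IH D Dm; rewrite uniq_seqsE /=.
apply/andP; split.
  by apply/flattenP => -[? /mapP[y _ ->] /mapP[]].
have: uniq (enum D) := enum_uniq _.
have: {subset enum D <= D} by move=> y; rewrite mem_enum.
elim: (enum D) => //= y ys IHys ysD /andP[yys uys].
rewrite cat_uniq IHys ?andbT //; last first.
  by move=> z zs; apply: ysD; rewrite in_cons zs orbT.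
rewrite map_inj_uniq; last by move=> ? ? [].
rewrite IH; last by move: Dm; rewrite (cardsD1 y) ysD ?mem_head.
apply/hasPn => ? /flattenP[? /mapP[z zys ->] /mapP[s _ ->]].
by apply/mapP => -[? _ [zy _]]; rewrite zy (negbTE yys) in zys.
Qed.

Lemma avoid_nil D : avoid D [::] = D.
Proof. by apply/setP => y; rewrite inE andbT. Qed.

Lemma avoid_cons D y s : avoid D (y :: s) = avoid (D :\ y) s.
Proof. by apply/setP => z; rewrite !inE negb_or andbA [_ && (z != y)]andbC. Qed.

Lemma avoid_cat D s t : avoid D (s ++ t) = avoid (avoid D s) t.
Proof. by apply/setP => z; rewrite !inE mem_cat negb_or andbA. Qed.

(** Expansion of an exit sum over loop-erased walks, obtained by applying
    [hit_sum_last_visit] to each new vertex of the erased path. *)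
Lemma exit_sum_saw D c x :
  lap_det D * exit_sum D c x =
  \sum_(s <- uniq_seqs D) path_weight x s * c (last x s) * lap_det (avoid D s).
Proof.
have [m] := ubnP #|D|; elim: m D x => // m IH D x Dm.
rewrite sum_uniq_seqs /= avoid_nil mul1r mulrDr mulrC; congr (_ + _).
rewrite mulr_sumr; apply: eq_bigr => y yD.
rewrite mulrCA [lap_det D * _]mulrC hit_sum_last_visit // IH; last first.
  by move: Dm; rewrite (cardsD1 y) yD.
by rewrite mulr_sumr; apply: eq_bigr => s _; rewrite avoid_cons !mulrA.
Qed.

(** Induction on the first path.  When its next vertex [y] is removed from
    [D], the exit sums from [b] lose the walks from [b] through [y]; by
    [exit_sum_split] these are [hit_sum D c y] and [hit_sum D d y] times a
    factor independent of [c] and [d], so they cancel in the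
    antisymmetrisation. *)
Lemma fomin_first_path D x b c d :
  \sum_(s <- uniq_seqs D) path_weight x s * (lap_det (avoid D s) *
     (c (last x s) * exit_sum (avoid D s) d b - d (last x s) * exit_sum (avoid D s) c b)) =
  lap_det D * (exit_sum D c x * exit_sum D d b - exit_sum D d x * exit_sum D c b).
Proof.
have [m] := ubnP #|D|; elim: m D x => // m IH D x Dm.
rewrite sum_uniq_seqs /= avoid_nil mul1r.
(* The identity for the next vertex [y]: only the part of the exit sums
   from [b] that avoids [y] survives on the right. *)
have key y : y \in D -> lap_det (D :\ y) *
    (exit_sum (D :\ y) c y * exit_sum (D :\ y) d b - exit_sum (D :\ y) d y *
      exit_sum (D :\ y) c b) =
    lap_det D * (hit_sum D c y * exit_sum D d b - hit_sum D d y * exit_sum D c b).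
  move=> yD; rewrite !(exit_sum_split _ b yD) mulrBr !mulrA -!hit_sum_last_visit //; ring.
transitivity (lap_det D * (c x * exit_sum D d b - d x * exit_sum D c b) + \sum_(y in D)
    lap_det D * (Q x y * hit_sum D c y * exit_sum D d b - Q x y * hit_sum D d y * exit_sum D c b)).
  congr (_ + _); apply: eq_bigr => y yD.
  under eq_bigr do rewrite avoid_cons -mulrA.
  rewrite -mulr_sumr IH; last by move: Dm; rewrite (cardsD1 y) yD.
  rewrite key //; ring.
rewrite -mulr_sumr -mulrDr sumrB -!mulr_suml [exit_sum D c x]/exit_sum [exit_sum D d x]/exit_sum.
by congr (_ * _); ring.
Qed.

(** The inner sum is the loop-erased expansion of the exit sums from [b] in the
    complement of the first path, so this is [fomin_first_path] in a form
    symmetric in the two paths: the determinantal identity of Fomin. *)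
Lemma fomin D x b c d :
  \sum_(s <- uniq_seqs D) \sum_(t <- uniq_seqs (avoid D s)) path_weight x s * path_weight b t *
     (c (last x s) * d (last b t) - d (last x s) * c (last b t)) *
     lap_det (avoid (avoid D s) t) =
  lap_det D * (exit_sum D c x * exit_sum D d b - exit_sum D d x * exit_sum D c b).
Proof.
rewrite -fomin_first_path; apply: eq_bigr => s _.
rewrite mulrBr !(mulrCA (lap_det _)) !exit_sum_saw !mulr_sumr -sumrB mulr_sumr.
apply: eq_bigr => t _; ring.
Qed.

End Killed.

(** * Traces of powers and determinants of symmetric matrices *)
Lemma diag_mxX (K : comPzRingType) n (d : 'rV[K]_n) k :
  (diag_mx d) ^+ k = diag_mx (\row_i d ord0 i ^+ k).
Proof.
elim: k => [|k IH].
  by rewrite expr0; apply/matrixP => i j; rewrite !mxE expr0.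
rewrite exprS IH; apply/matrixP => i j.
by rewrite -[_ * _]/(_ *m _) mul_diag_mx !mxE exprS mulrnAr.
Qed.

Lemma eigen_trace_det (K : fieldType) n (A P : 'M[K]_n) (d : 'rV[K]_n) :
  P \in unitmx -> A = invmx P *m diag_mx d *m P ->
  (forall k, \tr (A ^+ k) = \sum_i d ord0 i ^+ k) /\
  \det (1%:M - A) = \prod_i (1 - d ord0 i).
Proof.
move=> Pu AE.
have AX k : A ^+ k = invmx P *m (diag_mx d ^+ k) *m P.
  elim: k => [|k IH]; first by rewrite !expr0 mulmx1 mulVmx.
  by rewrite !exprS IH -![_ * _]/(_ *m _) {1}AE !mulmxA mulmxK // -!mulmxA.
split=> [k|].
  rewrite AX mxtrace_mulC !mulmxA mulmxV // mul1mx diag_mxX mxtrace_diag.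
  by apply: eq_bigr => i _; rewrite mxE.
have -> : 1%:M - A = invmx P *m (1%:M - diag_mx d) *m P.
  by rewrite AE mulmxBr mulmx1 mulmxBl mulVmx.
rewrite !det_mulmx det_inv mulrC mulrA mulfV ?mul1r; last first.
  by rewrite -unitfE -unitmxE.
rewrite -diag_const_mx -raddfB det_diag; apply: eq_bigr => i _.
by rewrite !mxE.
Qed.

(** The spectral theorem is applied over the complex extension of [R]; the
    eigenvalues are real there, and both identities descend to [R]. *)
Lemma symmetric_eigenvalues (R : rcfType) n (A : 'M[R]_n) : A^T = A ->
  exists d : 'I_n -> R, (forall k, \tr (A ^+ k) = \sum_i d i ^+ k) /\
    \det (1%:M - A) = \prod_i (1 - d i).
Proof.
move=> AT; pose f : {rmorphism R -> complex.complex R} := complex.real_complex R.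
have finj : injective f := fmorph_inj f.
have Asym : map_mx f A \is hermsymmx.
  apply: realsym_hermsym.
    apply/is_hermitianmxP; rewrite expr0 scale1r. by rewrite map_mx_id // map_trmx AT.
  by apply/mxOverP => i j; rewrite mxE; apply/complex.complex_realP; exists (A i j).
have dreal := hermitian_spectral_diag_real Asym.
have /orthomx_spectralP := hermitian_normalmx Asym.
set d := spectral_diag _ in dreal *.
have /all_sig[e eP] i : {e : R | d ord0 i = f e}.
  exists (complex.Re (d ord0 i)); rewrite /f /=.
  by rewrite complex.RRe_real //; exact: (mxOverP dreal).
move=> /(eigen_trace_det (spectral_unit _))[tE dE]; exists e; split=> [k|].
  apply: finj; rewrite [RHS]rmorph_sum /=.
  under eq_bigr do rewrite rmorphXn /= -eP.
  by rewrite -tE -rmorphXn /= -trace_map_mx.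
apply: finj; rewrite [RHS]rmorph_prod /=.
under eq_bigr do rewrite rmorphB rmorph1 /= -eP.
by rewrite -dE -det_map_mx rmorphB /= map_mx1.
Qed.

Local Open Scope classical_set_scope.

(** * The logarithmic series *)
(** Mean value theorem on [[0, 1]] for the remainder with [x] replaced by
    [x * s]: its derivative in [s] collapses, by the geometric sum, to
    [- x * (x * s) ^+ n / (1 - x * s)]. *)
Lemma ln_taylor_bound (R : realType) (x : R) n : `|x| < 1 ->
  `|ln (1 - x) + \sum_(k < n) x ^+ k.+1 / k.+1%:R| <= `|x| ^+ n * (1 - `|x|)^-1.
Proof.
move=> x1.
pose q : {poly R} := 1 - x *: 'X.
pose r : {poly R} := \sum_(k < n) (x ^+ k.+1 / k.+1%:R) *: 'X^(k.+1).
pose h : R -> R := (@ln R \o horner q) + horner r.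
have qE s : q.[s] = 1 - x * s by rewrite !hornerE.
have q_gt0 (s : R) : s \in `[0, 1]%R -> 0 < q.[s].
  rewrite in_itv /= => /andP[s0 s1]; rewrite qE subr_gt0.
  rewrite (le_lt_trans (ler_norm _)) // normrM (le_lt_trans _ x1) //.
  by rewrite ler_piMr // ger0_norm.
pose dh (s : R) : R := - x * (x * s) ^+ n / (1 - x * s).
have hd (s : R) : s \in `[0, 1]%R -> is_derive s 1 h (dh s).
  move=> s01; have q0 := q_gt0 _ s01.
  have hd1 : is_derive s 1 (@ln R \o horner q) (q.[s]^-1 * q^`().[s]).
    by apply: is_derive1_comp; exact: is_derive1_ln.
  have := is_deriveD hd1 (is_derive_poly r s).
  rewrite -/h => hd2; apply: is_derive_eq; rewrite /dh -qE.
  have -> : r^`().[s] = x * \sum_(k < n) (x * s) ^+ k.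
    rewrite /r raddf_sum /= horner_sum mulr_sumr; apply: eq_bigr => k _.
    rewrite derivZ derivXn /= hornerZ hornerMn hornerXn exprMn exprS.
    rewrite -mulr_natr; field.
    by rewrite nat1r pnatr_eq0.
  have -> : q^`().[s] = - x.
    by rewrite /q derivB -polyC1 derivC sub0r derivZ derivX hornerN hornerZ hornerC mulr1.
  have e := subrX1 (x * s) n.
  have -> : (x * s) ^+ n = 1 - q.[s] * \sum_(i < n) (x * s) ^+ i.
    by rewrite -[LHS](subrK 1) e qE; ring.
  field; exact: lt0r_neq0.
have hcont : {within `[0, 1], continuous h}.
  by apply: derivable_within_continuous => s /hd [].
have hd' (s : R) : s \in `]0, 1[%R -> is_derive s 1 h (dh s).
  by rewrite in_itv /= => /andP[s0 s1]; apply: hd; rewrite in_itv /= !ltW.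
have [c c01 hE] := MVT_segment ler01 hd' hcont.
have h0 : h 0 = 0.
  rewrite /h /= -[LHS]/(ln q.[0] + r.[0]) qE mulr0 subr0 ln1 add0r.
  rewrite /r horner_sum big1 // => k _.
  by rewrite hornerZ hornerXn expr0n /= mulr0.
have h1 : h 1 = ln (1 - x) + \sum_(k < n) x ^+ k.+1 / k.+1%:R.
  rewrite /h /= -[LHS]/(ln q.[1] + r.[1]) qE mulr1; congr (_ + _).
  rewrite /r horner_sum; apply: eq_bigr => k _.
  by rewrite hornerZ hornerXn expr1n mulr1.
rewrite -h1 -[h 1]subr0 -h0 hE subr0 mulr1 /dh normrM normrM normrN.
move: (c01); rewrite in_itv /= => /andP[c0 c1].
have xc : `|x * c| <= `|x| by rewrite normrM ler_piMr // ger0_norm.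
have ge0 : 0 < 1 - `|x| by rewrite subr_gt0.
apply: ler_pM; rewrite ?mulr_ge0 ?normr_ge0 //.
  rewrite normrX -[leRHS]mul1r; apply: ler_pM; rewrite ?exprn_ge0 //.
    exact: ltW.
  by rewrite lerXn2r // nnegrE normr_ge0.
rewrite normfV lef_pV2 ?posrE //; last first.
  by rewrite normr_gt0 lt0r_neq0 // -qE q_gt0.
rewrite (le_trans _ (ler_norm _)) // lerD2l lerN2.
by rewrite (le_trans (ler_norm _)).
Qed.

Lemma cvg_ln_series (R : realType) (x : R) : `|x| < 1 ->
  (fun n => \sum_(k < n) x ^+ k.+1 / k.+1%:R) @ \oo --> - ln (1 - x).
Proof.
move=> x1; rewrite -[X in _ --> X]add0r.
apply/cvgrPdist_le => e e0.
have : (fun n => `|x| ^+ n * (1 - `|x|)^-1) @ \oo --> (0 : R).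
  rewrite -[X in _ --> X](mul0r (1 - `|x|)^-1); apply: cvgMl.
  have -> : GRing.exp `|x| = geometric 1 `|x|.
    by apply/funext => k; rewrite /geometric /= mul1r.
  by apply: cvg_geometric; rewrite normr_id.
move=> /cvgrPdist_le/(_ _ e0); apply: filterS => n /=.
rewrite add0r sub0r normrN -opprD normrN => le.
rewrite (le_trans (ln_taylor_bound _ x1)) // (le_trans _ le) //.
by rewrite ler_norm.
Qed.

(** * Subcritical matrices *)
Lemma cvg_sum (R : realType) (I : Type) (r : seq I) (P : pred I)
    (F : I -> R^nat) (a : I -> R) :
  (forall i, P i -> F i @ \oo --> a i) ->
  (fun n => \sum_(i <- r | P i) F i n) @ \oo --> \sum_(i <- r | P i) a i.
Proof. by move=> Fa; apply: cvg_big => //; exact: add_continuous. Qed.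

(** The supersolution [phi] bounds the expected lifetime of the walk with
    transition weights [`|Q i j|]. *)
Definition subcritical (R : realType) N (Q : 'M[R]_N) : Prop :=
  exists2 phi : 'I_N -> R, (forall i, 0 <= phi i) &
    forall i, \sum_j `|Q i j| * phi j + 1 <= phi i.

Lemma subcritical_le (R : realType) N (P Q : 'M[R]_N) :
  (forall i j, `|Q i j| <= `|P i j|) -> subcritical P -> subcritical Q.
Proof.
move=> QP [phi phi0 phiP]; exists phi => // i; apply: le_trans (phiP i).
by rewrite lerD2r; apply: ler_sum => j _; rewrite ler_wpM2r.
Qed.

Lemma subcritical_killed (R : realType) N (Q : 'M[R]_N) D :
  subcritical Q -> subcritical (killed Q D).
Proof.
by apply: subcritical_le => i j; rewrite mxE; case: ifP => // _; rewrite normr0.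
Qed.

Section Subcritical.
Variables (R : realType) (N : nat) (Q : 'M[R]_N).
Hypothesis Qsub : subcritical Q.

(** Iterating the inequality for [phi] bounds the partial sums of
    the entries of [`|Q ^+ k|] by [phi]. *)
Lemma subcritical_pow_bound : exists M : R, forall n i j,
  \sum_(k < n) `|(Q ^+ k) i j| <= M.
Proof.
have [phi phi0 phiQ] := Qsub.
suff bd n i j : \sum_(k < n) `|(Q ^+ k) i j| <= phi i.
  exists (\sum_i phi i) => n i j; rewrite (le_trans (bd n i j)) //.
  by rewrite (bigD1 i) //= lerDl sumr_ge0.
elim: n i j => [|n IH] i j; first by rewrite big_ord0.
rewrite big_ord_recl expr0 mxE addrC (le_trans _ (phiQ i)) // lerD //; last first.
  by case: eqP => _; rewrite ?normr1 ?normr0.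
pose F l := `|Q i l| * \sum_(k < n) `|(Q ^+ k) l j|.
apply: (@le_trans _ _ (\sum_l F l)); last first.
  by apply: ler_sum => l _; rewrite /F ler_wpM2l.
rewrite /F; under [leRHS]eq_bigr do rewrite mulr_sumr.
rewrite exchange_big; apply: ler_sum => k _ /=.
rewrite exprS -[Q * _]/(Q *m _) mxE (le_trans (ler_norm_sum _ _ _)) //.
by apply: ler_sum => l _; rewrite normrM.
Qed.

Lemma subcritical_pow_cvg0 i j : (fun k => (Q ^+ k) i j) @ \oo --> 0.
Proof.
have [M Mb] := subcritical_pow_bound.
apply/norm_cvg0P; apply: cvg_series_cvg_0.
apply: nondecreasing_is_cvgn.
  by apply/nondecreasing_seqP => n; rewrite seriesEord /= big_ord_recr /= lerDl.
by exists M => _ [n _ <-]; rewrite seriesEord /=; exact: Mb.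
Qed.

Lemma subcritical_inverse_cvg i j : 1%:M - Q \in unitmx ->
  (fun n => \sum_(k < n) (Q ^+ k) i j) @ \oo --> invmx (1%:M - Q) i j.
Proof.
move=> Qu; set G := invmx _.
have geo n : \sum_(k < n) Q ^+ k = G - G *m Q ^+ n.
  have -> : G - G *m Q ^+ n = G *m (1%:M - Q ^+ n) by rewrite mulmxBr mulmx1.
  have -> : 1%:M - Q ^+ n = (1%:M - Q) *m \sum_(k < n) Q ^+ k.
    elim: n => [|n IH]; first by rewrite big_ord0 expr0 subrr mulmx0.
    rewrite big_ord_recr /= mulmxDr -IH mulmxBl mul1mx exprS.
    by rewrite -[Q * _]/(Q *m _) addrA subrK.
  by rewrite mulKmx.
have E n : \sum_(k < n) (Q ^+ k) i j = G i j - \sum_l G i l * (Q ^+ n) l j.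
  by rewrite -summxE geo !mxE.
rewrite (_ : (fun n => _) = (fun n => G i j - \sum_l G i l * (Q ^+ n) l j)); last first.
  by apply/funext => n.
rewrite -[X in _ --> X]subr0; apply: cvgB; first exact: cvg_cst.
rewrite [X in _ --> X](_ : _ = \sum_(l < N) G i l * 0); last first.
  by rewrite big1 // => l _; rewrite mulr0.
apply: (@cvg_sum _ _ _ _ (fun l n => G i l * (Q ^+ n) l j)) => l _; apply: cvgMr;
  exact: subcritical_pow_cvg0.
Qed.

Hypothesis Qsym : Q^T = Q.

(** Even traces tend to zero and dominate the even powers of each eigenvalue,
    so all eigenvalues lie in the open unit disk; the logarithm of the
    determinant is then the sum of their logarithmic series. *)
Lemma subcritical_det :
  0 < \det (1%:M - Q) /\
  (fun n => \sum_(k < n) \tr (Q ^+ k.+1) / k.+1%:R) @ \oo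
    --> - ln (\det (1%:M - Q)).
Proof.
have [e [trE detE]] := symmetric_eigenvalues Qsym.
have e1 i : `|e i| < 1.
  rewrite ltNge; apply/negP => ei.
  have : (fun k => \tr (Q ^+ k)) @ \oo --> 0.
    rewrite [X in _ --> X](_ : _ = \sum_(l < N) 0); last by rewrite big1.
    apply: (@cvg_sum _ _ _ _ (fun l k => (Q ^+ k) l l)) => l _; exact: subcritical_pow_cvg0.
  move=> /cvgrPdist_lt/(_ 1 ltr01)[n _ /(_ n.*2)] /=.
  rewrite -addnn leq_addl => /(_ isT); rewrite sub0r normrN trE ltNge => /negP.
  apply; rewrite (le_trans _ (ler_norm _)) // (bigD1 i) //=.
  rewrite -[leLHS]addr0 lerD // ?sumr_ge0 // => [|l _]; last first.
    by rewrite addnn -mul2n exprM exprn_ge0 // sqr_ge0.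
  by rewrite addnn -mul2n exprM -(real_normK (num_real (e i))) -exprM exprn_ege1.
have e_gt0 i : 0 < 1 - e i.
  by rewrite subr_gt0 (le_lt_trans (ler_norm _)).
rewrite detE; split; first by rewrite prodr_gt0.
have lnE (s : seq 'I_N) : ln (\prod_(i <- s) (1 - e i)) = \sum_(i <- s) ln (1 - e i).
  elim: s => [|i s IH]; first by rewrite !big_nil ln1.
  by rewrite !big_cons lnM ?posrE ?e_gt0 ?IH // prodr_gt0.
rewrite lnE -sumrN.
rewrite (_ : (fun n => _) = (fun n => \sum_i \sum_(k < n) e i ^+ k.+1 / k.+1%:R)).
  apply: (@cvg_sum _ _ _ _ (fun i n => \sum_(k < n) e i ^+ k.+1 / k.+1%:R)) => i _.
  exact: cvg_ln_series.
apply/funext => n; rewrite exchange_big; apply: eq_bigr => k _ /=.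
by rewrite trE mulr_suml.
Qed.

End Subcritical.

Section KilledSubcritical.
Variables (R : realType) (N : nat) (Q : 'M[R]_N).
Hypotheses (Qsub : subcritical Q) (Qsym : Q^T = Q).
Implicit Types (D : {set 'I_N}).

Lemma killed_sym D : (killed Q D)^T = killed Q D.
Proof. by apply/matrixP => i j; rewrite !mxE andbC -[in LHS]Qsym mxE. Qed.

Lemma lap_det_gt0 D : 0 < lap_det Q D.
Proof. by have [] := subcritical_det (subcritical_killed D Qsub) (killed_sym D). Qed.

Lemma lap_det_neq0 D : lap_det Q D != 0.
Proof. by rewrite lt0r_neq0 // lap_det_gt0. Qed.

Lemma cvg_ln_lap_det D :
  (fun n => \sum_(k < n) \tr (killed Q D ^+ k.+1) / k.+1%:R) @ \oo --> - ln (lap_det Q D).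
Proof. by have [] := subcritical_det (subcritical_killed D Qsub) (killed_sym D). Qed.

Lemma cvg_green D x y :
  (fun n => \sum_(k < n) (killed Q D ^+ k) x y) @ \oo --> green Q D x y.
Proof.
apply: subcritical_inverse_cvg; first exact: subcritical_killed.
by rewrite unitmxE unitfE lap_det_neq0.
Qed.

End KilledSubcritical.

(** * Sums over walks *)
Section WalkSums.
Variables (R : realType) (N : nat) (Q : 'M[R]_N).
Implicit Types (D : {set 'I_N}) (c : 'I_N -> R).

Definition walk_sum D c k x : R :=
  \sum_(t : k.-tuple 'I_N | all (mem D) t) path_weight Q x t * c (last x t).

Lemma walk_sum0 D c x : walk_sum D c 0 x = c x.
Proof.
rewrite /walk_sum (big_pred1 [tuple]) ?mul1r // => -[[|//] i] /=.
by apply/esym/eqP/val_inj.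
Qed.

Lemma walk_sumS D c k x : walk_sum D c k.+1 x = \sum_(y in D) Q x y * walk_sum D c k y.
Proof.
rewrite /walk_sum; under [RHS]eq_bigr do rewrite mulr_sumr.
rewrite pair_big_dep /=.
rewrite (reindex (fun p : 'I_N * k.-tuple 'I_N => [tuple of p.1 :: p.2])) /=.
  by apply: eq_bigr => p _ /=; rewrite mulrA.
exists (fun t => (thead t, [tuple of behead t])) => [[y t] _|t _] /=.
  by rewrite theadE; congr (_, _); apply/val_inj.
by rewrite [RHS]tuple_eta.
Qed.

Lemma walk_sum_pow D c k x : x \in D ->
  walk_sum D c k x = \sum_(y in D) (killed Q D ^+ k) x y * c y.
Proof.
elim: k x => [|k IH] x xD.
  rewrite walk_sum0 expr0 (bigD1 x) //= big1 ?addr0 ?mxE ?eqxx ?mul1r // => y.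
  by case/andP=> _ /negbTE yx; rewrite mxE eq_sym yx mul0r.
rewrite walk_sumS; under eq_bigr => y yD do rewrite IH // mulr_sumr.
rewrite exchange_big; apply: eq_bigr => y yD /=.
rewrite exprS -[_ * _ ^+ k]/(_ *m _) mxE mulr_suml big_mkcond /=.
apply: eq_bigr => z _; rewrite [killed _ _ x z]mxE xD /=.
by case: ifP; rewrite ?mul0r // mulrA.
Qed.

Lemma tr_pow D k : (0 < k)%N ->
  \tr (killed Q D ^+ k) = \sum_(x in D) walk_sum D (fun y => (y == x)%:R) k x.
Proof.
case: k => // k _; rewrite /mxtrace [RHS]big_mkcond; apply: eq_bigr => x _ /=.
case: ifPn => xD.
  rewrite walk_sum_pow // (bigD1 x) //= eqxx mulr1 big1 ?addr0 // => y.
  by case/andP=> _ /negbTE ->; rewrite mulr0.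
rewrite exprS -[_ * _ ^+ k]/(_ *m _) mxE big1 // => y _.
by rewrite mxE (negbTE xD) mul0r.
Qed.

Hypotheses (Qsub : subcritical Q) (Qsym : Q^T = Q).

(** The Neumann series of the Green function, read as a sum over walks. *)
Lemma cvg_walk_sum D c x :
  (fun n => \sum_(k < n) walk_sum D c k x) @ \oo --> exit_sum Q D c x.
Proof.
have hitC y : y \in D -> (fun n => \sum_(k < n) walk_sum D c k y) @ \oo --> hit_sum Q D c y.
  move=> yD.
  rewrite (_ : (fun n => _) =
     (fun n => \sum_(z in D) (\sum_(k < n) (killed Q D ^+ k) y z) * c z)).
    rewrite /hit_sum.
    apply: (@cvg_sum _ _ _ _ (fun z n => (\sum_(k < n) (killed Q D ^+ k) y z) * c z)) => z _.
    by apply: cvgMl; exact: cvg_green.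
  apply/funext => n; under eq_bigr do rewrite walk_sum_pow //.
  by rewrite exchange_big; apply: eq_bigr => z _; rewrite mulr_suml.
rewrite -(cvg_shiftS (fun n => \sum_(k < n) walk_sum D c k x)) /=.
rewrite (_ : (fun n => _) = (fun n => c x + \sum_(y in D) Q x y * (\sum_(k < n) walk_sum D c k y))).
  apply: cvgD; first exact: cvg_cst.
  apply: (@cvg_sum _ _ _ _ (fun y n => Q x y * (\sum_(k < n) walk_sum D c k y))) => y yD.
  by apply: cvgMr; exact: hitC.
apply/funext => n; rewrite big_ord_recl walk_sum0; congr (_ + _).
under eq_bigr do rewrite walk_sumS.
by rewrite exchange_big; apply: eq_bigr => y _; rewrite mulr_sumr.
Qed.

End WalkSums.

Lemma esum_uniq (R : realType) (T : choiceType) (l : seq T) (f : T -> \bar R) :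
  uniq l -> (forall x, x \in l -> (0 <= f x)%E) ->
  \esum_(x in [set x | x \in l]) f x = (\sum_(x <- l) f x)%E.
Proof.
move=> ul f0; rewrite esum_fset //; last by move=> i; rewrite inE => /f0.
by rewrite [RHS]fsbig_seq.
Qed.

Lemma esum_fintype (R : realType) (T : finType) (P : pred T) (f : T -> \bar R) :
  (forall x, P x -> (0 <= f x)%E) ->
  \esum_(x in [set x | P x]) f x = (\sum_(x | P x) f x)%E.
Proof.
move=> f0; rewrite -[RHS](big_enum _ _ P) /= -esum_uniq ?enum_uniq //.
- by congr esum; apply/seteqP; split=> x /=; rewrite mem_enum.
- by move=> x; rewrite mem_enum => /f0.
Qed.

Lemma esum_size (R : realType) (T : finType) (P : pred (seq T)) (f : seq T -> \bar R) :
  (forall s, (0 <= f s)%E) ->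
  \esum_(s in [set s | P s]) f s =
  (\sum_(k <oo) \sum_(t : k.-tuple T | P t) f t)%E.
Proof.
move=> f0.
pose F k := [set s : seq T | P s && (size s == k)].
have -> : [set s | P s] = \bigcup_k F k.
  apply/seteqP; split=> s /=; first by move=> Ps; exists (size s) => //=; rewrite /F /= Ps eqxx.
  by case=> k _ /andP[].
rewrite nneseries_sum_bigcup //; last first.
  by move=> i j _ _ [s [/= /andP[_ /eqP <-] /andP[_ /eqP <-]]].
apply: eq_eseriesr => k _.
rewrite -esum_fintype // (reindex_esum [set t : k.-tuple T | P t] (F k) (@tval k T)) //.
split=> [t /= Pt|s t _ _|s /= /andP[Ps sk]].
- by rewrite /F /= Pt size_tuple eqxx.
- exact: val_inj.
- by exists (Tuple sk).
Qed.

Lemma nneseries_cvg (R : realType) (u : R^nat) (l : R) : (forall k, 0 <= u k) ->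
  (fun n => \sum_(k < n) u k) @ \oo --> l ->
  (\sum_(k <oo) (u k)%:E)%E = l%:E.
Proof.
move=> u0 ul; have uE : (fun n => \sum_(0 <= k < n) (u k)%:E)%E =
  EFin \o (fun n => \sum_(k < n) u k).
  by apply/funext => n /=; rewrite big_mkord sumEFin.
apply/cvg_lim => //; rewrite uE; apply/fine_cvgP; split => //.
by apply: nearW.
Qed.

(** * The box and its transition matrices *)
Definition nbrs (x : Z2) : seq Z2 :=
  [:: (x.1 + 1, x.2); (x.1 - 1, x.2); (x.1, x.2 + 1); (x.1, x.2 - 1)].

Lemma adjE x y : adj x y = (y \in nbrs x).
Proof.
case: x y => [a b] [c d]; rewrite /adj /Re /Im /= !inE !xpair_eqE.
apply/eqP/idP; rewrite !expr2; last first.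
  by case/or4P => /andP[/eqP-> /eqP->]; ring.
move=> h.
set u := a - c in h *; set v := b - d in h *.
have hu : u * u <= 1 by rewrite -h lerDl -expr2 sqr_ge0.
have hv : v * v <= 1 by rewrite -h lerDr -expr2 sqr_ge0.
have {hu} [] : -1 <= u /\ u <= 1 by split; nia.
have {hv} [] : -1 <= v /\ v <= 1 by split; nia.
move=> v1 v2 u1 u2.
have {u1 u2} : u = 1 \/ u = -1 \/ u = 0 by lia.
have {v1 v2} : v = 1 \/ v = -1 \/ v = 0 by lia.
have ac : c = a - u by rewrite /u; ring.
have bd : d = b - v by rewrite /v; ring.
move=> [|[|]] ev [|[|]] eu; rewrite eu ev in h ac bd; clear -h ac bd; move=> /=; lia.
Qed.

Lemma adjC x y : adj x y = adj y x.
Proof.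
rewrite /adj -[Re x - Re y]opprB -[Im x - Im y]opprB !sqrrN; done.
Qed.

Lemma crossesC x y : crosses x y = crosses y x.
Proof.
rewrite /crosses eq_sym orbC; case: eqP => //= ->.
by rewrite ![(Re x == _) && _]andbC.
Qed.

Lemma uniq_nbrs x : uniq (nbrs x).
Proof. case: x => a b; rewrite /nbrs /= !inE !xpair_eqE; lia. Qed.

Section Box.
Variable n : nat.

Definition boxlist : seq Z2 :=
  [seq (i%:Z + 1 - n%:Z, j%:Z + 1 - n%:Z) | i <- iota 0 n.*2, j <- iota 0 n.*2.-1].

Lemma mem_boxlist x : (x \in boxlist) = box n x.
Proof.
apply/allpairsP/idP.
  case=> [[i j]] /= [] /[!mem_iota] hi hj ->; rewrite /box /Re /Im /=; lia.
case: x => a b; rewrite /box /Re /Im /= => h.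
exists (absz (a + n%:Z - 1)%R, absz (b + n%:Z - 1)%R) => /=; rewrite !mem_iota.
split; [lia|lia|congr (_, _); lia].
Qed.

Lemma uniq_boxlist : uniq boxlist.
Proof.
apply: allpairs_uniq; rewrite ?iota_uniq //.
by move=> [i j] [k l] /= _ _ [] h1 h2; congr (_, _); lia.
Qed.

Definition box_size := size boxlist.
Definition vtx (i : 'I_box_size) : Z2 := nth pt0 boxlist i.

Lemma box_vtx i : box n (vtx i).
Proof. by rewrite -mem_boxlist mem_nth. Qed.

Lemma vtx_inj : injective vtx.
Proof. by move=> i j /eqP; rewrite nth_uniq ?uniq_boxlist // => /eqP/val_inj. Qed.

Lemma sum_vtx (R : nmodType) (F : Z2 -> R) :
  \sum_i F (vtx i) = \sum_(z <- boxlist) F z.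
Proof. by rewrite [RHS](big_nth pt0) big_mkord. Qed.

Section Matrices.
Variable R : realType.

Definition walk_mx : 'M[R]_box_size :=
  \matrix_(i, j) if adj (vtx i) (vtx j) then 4^-1 else 0.

Definition signed_mx : 'M[R]_box_size :=
  \matrix_(i, j) if crosses (vtx i) (vtx j) then - walk_mx i j else walk_mx i j.

Lemma walk_mx_sym : walk_mx^T = walk_mx.
Proof. by apply/matrixP => i j; rewrite !mxE adjC. Qed.

Lemma signed_mx_sym : signed_mx^T = signed_mx.
Proof. by apply/matrixP => i j; rewrite !mxE adjC crossesC. Qed.

Lemma walk_mx_ge0 i j : 0 <= walk_mx i j.
Proof. by rewrite mxE; case: ifP. Qed.

Lemma norm_signed_mx i j : `|signed_mx i j| = walk_mx i j.
Proof.
by rewrite mxE; case: ifP => _; rewrite ?normrN ger0_norm // walk_mx_ge0.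
Qed.

(** The supersolution is [2 * ((n + 1) ^+ 2 - x ^+ 2)]: the average of [x ^+ 2]
    over the four neighbours exceeds [x ^+ 2] by one half, and the function is
    still nonnegative on the neighbours that lie outside the box. *)
Lemma walk_mx_subcritical : subcritical walk_mx.
Proof.
pose f (z : Z2) : R := 2 * ((n%:R + 1) ^+ 2 - (z.1)%:~R ^+ 2).
have f_ge0 (z : Z2) : - n%:Z <= z.1 <= n%:Z + 1 -> 0 <= f z.
  rewrite -!(ler_int R) intrD intrN -[n%:Z%:~R]/(n%:R) /f.
  move=> /andP[]; have : 0 <= n%:R :> R by [].
  move: (z.1%:~R : R) (n%:R : R) => a m m0 h1 h2.
  have -> : (m + 1) ^+ 2 - a ^+ 2 = (m + 1 - a) * (m + 1 + a) by ring.
  rewrite mulr1z in h2; rewrite !mulr_ge0 ?subr_ge0 //.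
  by rewrite addrAC addr_ge0 // -lerBlDl sub0r.
exists (fun i => f (vtx i)) => i.
  by apply: f_ge0; have := box_vtx i; rewrite /box /Re; lia.
have bi := box_vtx i.
under eq_bigr do rewrite ger0_norm ?walk_mx_ge0 // mxE.
rewrite (sum_vtx (fun z => (if adj (vtx i) z then 4^-1 else 0) * f z)).
have -> : \sum_(z <- boxlist) (if adj (vtx i) z then 4^-1 else 0) * f z =
    \sum_(z <- nbrs (vtx i) | box n z) 4^-1 * f z.
  rewrite (bigID (adj (vtx i))) /= [X in _ + X]big1 ?addr0; last first.
    by move=> z /negbTE->; rewrite mul0r.
  rewrite -big_filter -[RHS]big_filter.
  rewrite (perm_big [seq z <- nbrs (vtx i) | box n z]); last first.
    apply: uniq_perm; rewrite ?filter_uniq ?uniq_boxlist ?uniq_nbrs //.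
    by move=> z; rewrite !mem_filter adjE mem_boxlist andbC.
  apply: eq_big_seq => z; rewrite mem_filter => /andP[_ zi].
  by rewrite adjE zi.
apply: (@le_trans _ _ (\sum_(z <- nbrs (vtx i)) 4^-1 * f z + 1)).
  rewrite lerD2r big_mkcond big_seq [leRHS]big_seq; apply: ler_sum => z zi.
  case: ifP => // _; rewrite mulr_ge0 // f_ge0 //.
  by move: zi bi; rewrite /nbrs /box /Re !inE; case: (vtx i) z => a b [c d];
    rewrite !xpair_eqE /=; lia.
rewrite /nbrs !big_cons big_nil /f /= !rmorphD !rmorphN /=. lra.
Qed.

Lemma signed_mx_subcritical : subcritical signed_mx.
Proof.
apply: subcritical_le walk_mx_subcritical => i j.
by rewrite norm_signed_mx ger0_norm // walk_mx_ge0.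
Qed.

End Matrices.

Hypothesis n_gt0 : (0 < n)%N.

Lemma box0 : box n pt0. Proof. by rewrite /box /Re /Im /=; lia. Qed.
Lemma box1 : box n pt1. Proof. by rewrite /box /Re /Im /=; lia. Qed.

Lemma box_size_gt0 : (0 < box_size)%N.
Proof. by have := box0; rewrite -mem_boxlist /box_size; case: boxlist. Qed.

(** Points outside the box are sent to an arbitrary index. *)
Definition vtx_idx (z : Z2) : 'I_box_size := insubd (Ordinal box_size_gt0) (index z boxlist).

Lemma vtx_idxK z : box n z -> vtx (vtx_idx z) = z.
Proof.
move=> bz; rewrite /vtx /vtx_idx insubdK ?nth_index ?mem_boxlist //.
by rewrite -topredE /= index_mem mem_boxlist.
Qed.

Lemma vtxK i : vtx_idx (vtx i) = i.
Proof. by apply: vtx_inj; rewrite vtx_idxK ?box_vtx. Qed.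

End Box.

(** * Reflections of the box *)
Section Reflection.
Variables (n : nat) (n_gt0 : (0 < n)%N) (R : realType).
Local Notation I := 'I_(box_size n).
Local Notation P := (walk_mx n R).
Local Notation Q := (signed_mx n R).
Local Notation vtx_idx := (vtx_idx n_gt0).
Local Notation i0 := (vtx_idx pt0).
Local Notation i1 := (vtx_idx pt1).

Definition off01 : {set I} := [set i | (vtx i != pt0) && (vtx i != pt1)].
Definition slit : {set I} := [set i | ~~ half_line (vtx i)].

(** The weight of the step from the leftmost column of the box to the side
    [Re = -n]; likewise [exit_right] for the side [Re = n + 1]. *)
Definition exit_left (i : I) : R := if Re (vtx i) == 1 - n%:Z then 4^-1 else 0.
Definition exit_right (i : I) : R := if Re (vtx i) == n%:Z then 4^-1 else 0.

Let Qsub := signed_mx_subcritical n R.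
Let Psub := walk_mx_subcritical n R.
Let dtQ := lap_det_neq0 Qsub (signed_mx_sym n R).
Let dtP := lap_det_neq0 Psub (walk_mx_sym n R).

Definition sgn_of (b : bool) : R := if b then -1 else 1.

Definition zmirror (z : Z2) : Z2 := (z.1, - z.2).
Definition zswap (z : Z2) : Z2 := (1 - z.1, z.2).
Definition mirror (i : I) : I := vtx_idx (zmirror (vtx i)).
Definition swap (i : I) : I := vtx_idx (zswap (vtx i)).

Lemma vtx_mirror i : vtx (mirror i) = zmirror (vtx i).
Proof.
by rewrite vtx_idxK //; have := box_vtx i; case: (vtx i) => a b; rewrite /box /Re /Im /=; lia.
Qed.

Lemma vtx_swap i : vtx (swap i) = zswap (vtx i).
Proof.
by rewrite vtx_idxK //; have := box_vtx i; case: (vtx i) => a b; rewrite /box /Re /Im /=; lia.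
Qed.

Lemma mirrorK : involutive mirror.
Proof. by move=> i; apply: vtx_inj; rewrite !vtx_mirror; case: (vtx i) => a b;
  rewrite /zmirror /= opprK. Qed.

Lemma swapK : involutive swap.
Proof.
move=> i; apply: vtx_inj; rewrite !vtx_swap; case: (vtx i) => a b.
by rewrite /zswap /=; congr (_, _); ring.
Qed.

Lemma vtx_i0 : vtx i0 = pt0. Proof. by rewrite vtx_idxK // box0. Qed.
Lemma vtx_i1 : vtx i1 = pt1. Proof. by rewrite vtx_idxK // box1. Qed.

Lemma mirror_i0 : mirror i0 = i0.
Proof. by rewrite /mirror vtx_i0. Qed.
Lemma mirror_i1 : mirror i1 = i1.
Proof. by rewrite /mirror vtx_i1. Qed.
Lemma swap_i0 : swap i0 = i1.
Proof. by rewrite /swap vtx_i0. Qed.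

Lemma mirror_off01 i : (mirror i \in off01) = (i \in off01).
Proof.
rewrite !inE vtx_mirror; case: (vtx i) => a b; rewrite /zmirror !xpair_eqE /=; lia.
Qed.

Lemma swap_off01 i : (swap i \in off01) = (i \in off01).
Proof.
rewrite !inE vtx_swap; case: (vtx i) => a b; rewrite /zswap !xpair_eqE /=; lia.
Qed.

Definition gauge (i : I) : R := sgn_of (1 <= Re (vtx i)).

Lemma gauge2 i : gauge i * gauge i = 1.
Proof. by rewrite /gauge /sgn_of; case: ifP; rewrite ?mulrNN mulr1. Qed.

Lemma signed_mxE i j : Q i j =
  if adj (vtx i) (vtx j) then sgn_of (crosses (vtx i) (vtx j)) * 4^-1 else 0.
Proof.
by rewrite !mxE /sgn_of; case: ifP; case: ifP; rewrite ?oppr0 ?mulN1r ?mul1r.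
Qed.

(** The zipper, its mirror image and the edge [01] make up all the edges
    between the columns [Re = 0] and [Re = 1], and [gauge] changes sign exactly
    across these.  Hence mirroring amounts to a change of gauge, except on the
    edge [01]. *)
Lemma mirror_gauge i j : (i \in off01) || (j \in off01) ->
  Q (mirror i) (mirror j) = gauge i * Q i j * gauge j.
Proof.
rewrite !inE !signed_mxE !vtx_mirror /gauge /sgn_of !adjE.
case: (vtx i) (vtx j) => a b [c d]; rewrite /zmirror /nbrs /crosses /Re /Im !inE !xpair_eqE /=
  => ij.
rewrite (_ : [|| _, _, _ | _] = [|| (c == a + 1) && (d == b), (c == a - 1) && (d == b),
  (c == a) && (d == b + 1) | (c == a) && (d == b - 1)]); last by lia.
case: ifP => [cd|_]; last by rewrite mulr0 mul0r.
case: ifP => h1; case: ifP => h2; case: ifP => h3; case: ifP => h4;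
  rewrite ?mulN1r ?mul1r ?mulrN1 ?mulr1 ?opprK //; exfalso; lia.
Qed.

Lemma swap_signed_mx i j : Q (swap i) (swap j) = Q i j.
Proof.
rewrite !signed_mxE !vtx_swap /sgn_of !adjE.
case: (vtx i) (vtx j) => a b [c d]; rewrite /zswap /nbrs /crosses /Re /Im !inE !xpair_eqE /=.
by do ![case: ifP => ?] => //; exfalso; lia.
Qed.

Section Gauge.
Variables (c : I -> R) (s : R).
Hypothesis s2 : s * s = 1.
Hypothesis cs : forall i, c (mirror i) = s * gauge i * c i.

(** Both sides solve the system that determines [hit_sum]. *)
Lemma hit_sum_mirror i : i \in off01 ->
  hit_sum Q off01 c (mirror i) = s * gauge i * hit_sum Q off01 c i.
Proof.
move=> iA.
suff <- : s * gauge i * hit_sum Q off01 c (mirror i) = hit_sum Q off01 c i.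
  by rewrite mulrA mulrACA s2 gauge2 !mul1r.
move: i iA; apply: (hit_sum_uniq dtQ (u := fun i => s * gauge i *
  hit_sum Q off01 c (mirror i))) => j jA.
rewrite (hit_sum_eq dtQ) ?mirror_off01 // /exit_sum cs mulrDr mulrA mulrACA s2 gauge2 !mul1r.
congr (_ + _); rewrite mulr_sumr (reindex_inj (can_inj mirrorK)).
apply: eq_big => k; first by rewrite mirror_off01.
rewrite mirror_off01 => kA; rewrite mirror_gauge ?jA //.
have := gauge2 j; set g := gauge j; set h := gauge k; move=> g2.
transitivity ((g * g) * (s * h * Q j k * hit_sum Q off01 c (mirror k))); first by ring.
by rewrite g2; ring.
Qed.

Lemma exit_sum_mirror i : mirror i = i ->
  exit_sum Q off01 c i = s * gauge i * exit_sum Q off01 c i.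
Proof.
move=> ii; rewrite {1}/exit_sum (reindex_inj (can_inj mirrorK)) /=.
rewrite -{1}ii cs /exit_sum mulrDr; congr (_ + _); rewrite mulr_sumr.
apply: eq_big => k; first by rewrite mirror_off01.
rewrite mirror_off01 => kA; rewrite -{1}ii mirror_gauge ?kA ?orbT // hit_sum_mirror //.
have := gauge2 k; set g := gauge k; set h := gauge i; move=> g2.
transitivity ((g * g) * (s * h * Q i k * hit_sum Q off01 c k)); first by ring.
by rewrite g2; ring.
Qed.
End Gauge.

Lemma exit_left_mirror i : exit_left (mirror i) = 1 * gauge i * exit_left i.
Proof.
rewrite /exit_left /gauge /sgn_of vtx_mirror mul1r /zmirror /Re /=.
by do ![case: ifP => ?]; rewrite ?mulr0 ?mul1r //; exfalso; lia.
Qed.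

Lemma exit_right_mirror i : exit_right (mirror i) = -1 * gauge i * exit_right i.
Proof.
rewrite /exit_right /gauge /sgn_of vtx_mirror /zmirror /Re /=.
by do ![case: ifP => ?]; rewrite ?mulr0 ?mulrNN ?mul1r //; exfalso; lia.
Qed.

Lemma gauge_i0 : gauge i0 = 1.
Proof. by rewrite /gauge vtx_i0. Qed.

Lemma gauge_i1 : gauge i1 = -1.
Proof. by rewrite /gauge vtx_i1. Qed.

Let eqN (x : R) : x = - x -> x = 0.
Proof. by move=> e; lra. Qed.

(** The vertex [0] is fixed by the mirror, while the exit weight on the right
    is odd under mirror and gauge: the sum equals its opposite. *)
Lemma exit_sum_right0 : exit_sum Q off01 exit_right i0 = 0.
Proof.
apply: eqN; rewrite {1}(exit_sum_mirror (s := -1) _ exit_right_mirror) ?mirror_i0 ?mulrNN ?mulr1 //.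
by rewrite gauge_i0 mulr1 mulN1r.
Qed.

(** The exit weight on the left is even, but the gauge at [1] is [-1]. *)
Lemma exit_sum_left1 : exit_sum Q off01 exit_left i1 = 0.
Proof.
apply: eqN; rewrite {1}(exit_sum_mirror (s := 1) _ exit_left_mirror) ?mirror_i1 ?mulr1 //.
by rewrite gauge_i1 mul1r mulN1r.
Qed.

Lemma hit_sum_swap i : i \in off01 -> hit_sum Q off01 exit_right (swap i) =
  hit_sum Q off01 exit_left i.
Proof.
move: i; apply: (hit_sum_uniq dtQ (u := fun i => hit_sum Q off01 exit_right (swap i))) => j jA.
rewrite (hit_sum_eq dtQ) ?swap_off01 // /exit_sum; congr (_ + _).
  by rewrite /exit_right /exit_left vtx_swap /zswap /Re /=; do ![case: ifP => ?] => //; exfalso;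
    lia.
rewrite (reindex_inj (can_inj swapK)) /=.
by apply: eq_big => k; rewrite ?swap_off01 // swap_signed_mx.
Qed.

Lemma exit_sum_right1 : exit_sum Q off01 exit_right i1 = exit_sum Q off01 exit_left i0.
Proof.
rewrite -swap_i0 /exit_sum; congr (_ + _).
  by rewrite /exit_right /exit_left vtx_swap vtx_i0 /zswap /Re /=; do ![case: ifP => ?] => //;
    exfalso; lia.
rewrite (reindex_inj (can_inj swapK)) /=.
apply: eq_big => k; rewrite ?swap_off01 // => kA.
by rewrite swap_signed_mx hit_sum_swap.
Qed.

Lemma slit_off01 : slit \subset off01.
Proof.
apply/fintype.subsetP => i; rewrite !inE; case: (vtx i) => a b.
rewrite /half_line /Re /Im !xpair_eqE /=; lia.
Qed.

(** On the ray [x >= 2] the mirror acts trivially and the gauge is [-1]. *)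
Lemma hit_sum_ray i : i \in off01 -> i \notin slit -> hit_sum Q off01 exit_left i = 0.
Proof.
move=> iA iS; apply: eqN.
have mi : mirror i = i.
  apply: vtx_inj; rewrite vtx_mirror; move: iS; rewrite inE negbK.
  by case: (vtx i) => a b; rewrite /half_line /zmirror /Im /= => /andP[_ /eqP->]; rewrite oppr0.
rewrite -{1}mi (hit_sum_mirror (s := 1) _ exit_left_mirror) ?mulr1 // mul1r.
suff -> : gauge i = -1 by rewrite mulN1r.
rewrite /gauge /sgn_of ifT //; move: iA iS; rewrite !inE.
by case: (vtx i) => a b; rewrite /half_line !xpair_eqE /Re /Im /=; lia.
Qed.

(** In the box slit along the nonnegative real axis the zipper is the whole
    boundary of this region, so its signs can be gauged away. *)
Definition below (i : I) : R := sgn_of ((1 <= Re (vtx i)) && (Im (vtx i) < 0)).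

Lemma below2 i : below i * below i = 1.
Proof. by rewrite /below /sgn_of; case: ifP; rewrite ?mulrNN mulr1. Qed.

Lemma slit_gauge i j : i \in slit -> j \in slit -> Q i j = below i * P i j * below j.
Proof.
rewrite !inE signed_mxE mxE /below /sgn_of !adjE.
case: (vtx i) (vtx j) => a b [c d]; rewrite /half_line /nbrs /crosses /Re /Im !inE !xpair_eqE /=
  => hi hj.
case: ifP => [cd|_]; last by rewrite mulr0 mul0r.
by do ![case: ifP => ?]; rewrite ?mulN1r ?mul1r ?mulrN1 ?mulr1 ?opprK //; exfalso; lia.
Qed.

Lemma sum_slit (F : I -> R) : (forall i, i \in off01 -> i \notin slit -> F i = 0) ->
  \sum_(i in off01) F i = \sum_(i in slit) F i.
Proof.
move=> F0; rewrite (bigID (mem slit)) /= [X in _ + X]big1 ?addr0.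
  by apply: eq_bigl => i; case: (boolP (i \in slit)) => iS;
    rewrite ?andbF // (fintype.subsetP slit_off01 _ iS).
by move=> i /andP[iA iS]; exact: F0.
Qed.

(** Since the signed sum vanishes on the ray, it satisfies the equations of
    the walk killed there, and the gauge removes the signs. *)
Lemma hit_sum_slit i : i \in slit ->
  below i * hit_sum Q off01 exit_left i = hit_sum P slit exit_left i.
Proof.
move: i; apply: (hit_sum_uniq dtP (u := fun i => below i * hit_sum Q off01 exit_left i)) => j jS.
rewrite (hit_sum_eq dtQ) ?(fintype.subsetP slit_off01 _ jS) // /exit_sum mulrDr; congr (_ + _).
  move: jS; rewrite inE /exit_left /below /sgn_of /half_line; case: ifP => ?; case: ifP => ?;
    rewrite ?mulr0 ?mul1r // => ?.
  by exfalso; lia.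
rewrite sum_slit => [|k kA kS]; last by rewrite hit_sum_ray // mulr0.
rewrite mulr_sumr; apply: eq_bigr => k kS; rewrite slit_gauge //.
have := below2 j; set g := below j; set h := below k; move=> g2.
transitivity ((g * g) * (P j k * h * hit_sum Q off01 exit_left k)); first by ring.
by rewrite g2; ring.
Qed.

Lemma exit_sum_left0 : exit_sum Q off01 exit_left i0 = exit_sum P slit exit_left i0.
Proof.
rewrite /exit_sum; congr (_ + _).
rewrite sum_slit => [|k kA kS]; last by rewrite hit_sum_ray // mulr0.
apply: eq_bigr => k kS; rewrite -hit_sum_slit // mulrA; congr (_ * _).
move: kS; rewrite inE signed_mxE mxE /below /sgn_of !adjE vtx_i0.
case: (vtx k) => a b; rewrite /half_line /nbrs /crosses /Re /Im !inE !xpair_eqE /= => hk.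
case: ifP => [cd|_]; last by rewrite mul0r.
by do ![case: ifP => ?]; rewrite ?mulN1r ?mul1r ?mulrN1 ?mulr1 ?opprK //; exfalso; lia.
Qed.

End Reflection.

(** * Crossing parities in the plane *)
Fixpoint parity (T : Type) (f : rel T) (x : T) (s : seq T) : bool :=
  if s is y :: s' then f x y (+) parity f y s' else false.

Lemma odd_crossingsE x s : odd (crossings (x :: s)) = parity crosses x s.
Proof.
rewrite /crossings /=; elim: s x => //= y s IH x.
by rewrite oddD IH oddb.
Qed.

Lemma parity_cat (T : Type) (f : rel T) x s t :
  parity f x (s ++ t) = parity f x s (+) parity f (last x s) t.
Proof. by elim: s x => //= y s IH x; rewrite IH addbA. Qed.

Lemma parityD (T : Type) (f g : rel T) x s :
  parity (fun x y => f x y (+) g x y) x s = parity f x s (+) parity g x s.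
Proof. by elim: s x => //= y s IH x; rewrite IH addbACA. Qed.

Lemma eq_parity_in (T : eqType) (e : rel T) (f g : rel T) x s :
  (forall y z, e y z -> f y z = g y z) -> path e x s -> parity f x s = parity g x s.
Proof. by move=> fg; elim: s x => //= y s IH x /andP[xy ys]; rewrite fg // IH. Qed.

Lemma parity_false (T : eqType) (f : rel T) x s :
  (forall y z, y \in x :: s -> z \in x :: s -> f y z = false) -> parity f x s = false.
Proof.
elim: s x => //= y s IH x f0; rewrite f0 ?inE ?eqxx ?orbT // IH // => z w zs ws.
by rewrite f0 // inE ?zs ?ws orbT.
Qed.

(** A path enters and leaves [p] alternately. *)
Lemma parity_boundary (T : eqType) (p : pred T) x s :
  parity (fun y z => p y (+) p z) x s = p x (+) p (last x s).
Proof.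
elim: s x => [|y s IH] x /=; first by rewrite addbb.
by rewrite IH addbA -(addbA (p x)) addbb addbF.
Qed.

(** The edges crossed by the vertical half-line going down from the unit
    square of lower left corner [(a, b)].  For a closed path, the parity of the
    crossings of this half-line is the winding number modulo two around that
    square. *)
Definition ray (a b : int) : rel Z2 := fun x y =>
  [&& Im x == Im y, Im x <= b
    & (Re x == a) && (Re y == a + 1) || (Re x == a + 1) && (Re y == a)].

Definition edge (u v : Z2) : rel Z2 := fun x y =>
  (x == u) && (y == v) || (x == v) && (y == u).

Lemma crossesE : crosses =2 ray 0 (-1).
Proof.
move=> [a b] [c d]; rewrite /crosses /ray /Re /Im /=; lia.
Qed.

Lemma edgeC u v : edge u v =2 edge v u.
Proof. by move=> x y; rewrite /edge orbC. Qed.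

Lemma edge_sym u v x y : edge u v x y = edge u v y x.
Proof. by rewrite /edge orbC ![(y == _) && _]andbC. Qed.

Lemma ray_sym a b x y : ray a b x y = ray a b y x.
Proof.
rewrite /ray eq_sym; case: eqP => //= ->.
by rewrite orbC ![(Re y == _) && _]andbC.
Qed.

Lemma ray_h a b c d : ray a b (c, d) (c + 1, d) = (c == a) && (d <= b).
Proof.
rewrite /ray /Re /Im /= eqxx /= andbC; congr (_ && _).
by apply/idP/idP; lia.
Qed.

Lemma ray_v a b c d : ray a b (c, d) (c, d + 1) = false.
Proof. by rewrite /ray /Im /=; case: eqP => //; lia. Qed.

Lemma edge_hh a b c d : edge (a, b) (a + 1, b) (c, d) (c + 1, d) = (c == a) && (d == b).
Proof. by rewrite /edge !xpair_eqE /=; apply/idP/idP; lia. Qed.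

Lemma edge_hv a b c d : edge (a, b) (a + 1, b) (c, d) (c, d + 1) = false.
Proof. by rewrite /edge !xpair_eqE /=; apply/negP; lia. Qed.

Lemma edge_vh a b c d : edge (a, b) (a, b + 1) (c, d) (c + 1, d) = false.
Proof. by rewrite /edge !xpair_eqE /=; apply/negP; lia. Qed.

Lemma edge_vv a b c d : edge (a, b) (a, b + 1) (c, d) (c, d + 1) = (c == a) && (d == b).
Proof. by rewrite /edge !xpair_eqE /=; apply/idP/idP; lia. Qed.

Lemma adj_ind (T : Z2 -> Z2 -> Prop) :
  (forall x y, T x y -> T y x) ->
  (forall c d, T (c, d) (c + 1, d)) -> (forall c d, T (c, d) (c, d + 1)) ->
  forall x y, adj x y -> T x y.
Proof.
move=> Tsym Th Tv [c d] y; rewrite adjE !inE /=.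
case/or4P => /eqP->; rewrite ?Th ?Tv //; apply: Tsym.
  by have := Th (c - 1) d; rewrite subrK.
by have := Tv c (d - 1); rewrite subrK.
Qed.

(** Two vertically adjacent squares differ by their common edge. *)
Lemma rayV a b x s : path adj x s ->
  parity (ray a b) x s =
  parity (ray a (b - 1)) x s (+) parity (edge (a, b) (a + 1, b)) x s.
Proof.
move=> xs; rewrite -parityD; apply: (eq_parity_in _ xs); apply: adj_ind => [y z|c d|c d].
- by rewrite !(ray_sym _ _ y) (edge_sym _ _ y).
- rewrite !ray_h edge_hh; case: (c == a) => //=.
  have -> : (d <= b - 1) = (d < b) by apply/idP/idP; lia.
  by case: ltrgtP.
- by rewrite !ray_v edge_hv.
Qed.

Definition column (a b : int) : pred Z2 := fun x => (Re x == a) && (Im x <= b).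

(** Two horizontally adjacent squares differ by their common edge, up to the
    contribution of the endpoints: the edges that leave the column of vertices
    between the two half-lines are those crossing one of them and the common
    edge. *)
Lemma rayH a b x s : path adj x s ->
  parity (ray (a - 1) b) x s (+) parity (ray a b) x s =
  parity (edge (a, b) (a, b + 1)) x s (+)
    (column a b x (+) column a b (last x s)).
Proof.
move=> xs; rewrite -parity_boundary -!parityD; apply: (eq_parity_in _ xs);
  apply: adj_ind => [y z|c d|c d].
- by rewrite !(ray_sym _ _ y) (edge_sym _ _ y) (addbC (column a b y)).
- rewrite !ray_h edge_vh /column /Re /Im /= addbC; congr (_ (+) (_ && _)).
  by apply/idP/idP; lia.
- rewrite !ray_v edge_vv /column /Re /Im /=; case: (c == a) => //=.
  have -> : (d + 1 <= b) = (d < b) by apply/idP/idP; lia.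
  by case: ltrgtP.
Qed.

(** The half-lines descending from the four squares around [v], named after
    the direction of the square from [v]. *)
Definition sw (v : Z2) := ray (v.1 - 1) (v.2 - 1).
Definition se (v : Z2) := ray v.1 (v.2 - 1).
Definition nw (v : Z2) := ray (v.1 - 1) v.2.
Definition ne (v : Z2) := ray v.1 v.2.

Definition east (v : Z2) : Z2 := (v.1 + 1, v.2).
Definition west (v : Z2) : Z2 := (v.1 - 1, v.2).
Definition north (v : Z2) : Z2 := (v.1, v.2 + 1).
Definition south (v : Z2) : Z2 := (v.1, v.2 - 1).

Lemma eq_parity (T : Type) (f g : rel T) x s : f =2 g -> parity f x s = parity g x s.
Proof. by move=> fg; elim: s x => //= y s IH x; rewrite fg IH. Qed.

Section Around.
Variables (x : Z2) (s : seq Z2) (v : Z2).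
Hypothesis xs : path adj x s.
Hypothesis cl : column v.1 v.2 x = column v.1 v.2 (last x s).
Hypothesis cl' : column v.1 (v.2 - 1) x = column v.1 (v.2 - 1) (last x s).

(** When the endpoints of the path do not interfere with the column of [v],
    the parities of consecutive squares around [v] differ by the number of
    traversals of the edge that separates them. *)
Lemma around :
  [/\ parity (ne v) x s = parity (se v) x s (+) parity (edge v (east v)) x s,
      parity (nw v) x s = parity (ne v) x s (+) parity (edge v (north v)) x s,
      parity (nw v) x s = parity (sw v) x s (+) parity (edge v (west v)) x s
    & parity (sw v) x s = parity (se v) x s (+) parity (edge v (south v)) x s].
Proof.
case: v cl cl' => a b /= cl1 cl2.
have h1 := rayH a b xs; have h2 := rayH a (b - 1) xs.
move: h1 h2; rewrite cl1 cl2 !addbb !addbF => h1 h2.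
rewrite /ne /nw /se /sw /=; split.
- exact: rayV.
- by rewrite [_ (+) parity (edge _ _) _ _]addbC -h1 -addbA addbb addbF.
- rewrite (rayV _ _ xs) subrK; congr (_ (+) _).
  by apply: eq_parity => y z; rewrite edgeC.
- rewrite -[LHS](addbK (parity (ray a (b - 1)) x s)) h2 addbC subrK; congr (_ (+) _).
  by apply: eq_parity => y z; rewrite edgeC.
Qed.

End Around.

Lemma parity_edge_notinl u v x s : u \notin x :: s -> parity (edge u v) x s = false.
Proof.
move=> us; apply: parity_false => y z ys zs; rewrite /edge.
case: eqP ys => [->|_ _]; first by rewrite (negbTE us).
by case: (z =P u) zs => [->|_ _]; rewrite ?(negbTE us) // andbF.
Qed.

Lemma parity_edge_notinr u v x s : v \notin x :: s -> parity (edge u v) x s = false.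
Proof. by move=> vs; rewrite (eq_parity _ _ (edgeC u v)) parity_edge_notinl. Qed.

Section LoopParity.
Variables (n : nat) (x : Z2) (s : seq Z2).
Hypotheses (xs : path adj x s) (closed : last x s = x).
Hypothesis sbox : all (box n) (x :: s).

Let faces_agree v : v \notin x :: s ->
  [/\ parity (ne v) x s = parity (se v) x s, parity (nw v) x s = parity (se v) x s
    & parity (sw v) x s = parity (se v) x s].
Proof.
move=> vs; have [] := @around x s v xs; rewrite ?closed //.
by rewrite !parity_edge_notinl // !addbF => -> -> _ ->.
Qed.

(** Around a vertex that the closed path avoids, the four squares have the
    same parity.  Adjacent vertices share a square, so the parity is constant
    along [l :: p]; it vanishes at [l], as the square on the left of [l] lies
    outside the box.  The square to the south east of [0] gives the zipper. *)
Lemma loop_even l p : Re l = - n%:Z -> path adj l p ->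
  {in l :: p, forall v, v \notin x :: s} -> pt0 \in l :: p ->
  parity crosses x s = false.
Proof.
move=> ln lp avoid0 p0.
suff H : {in l :: p, forall v, parity (se v) x s = false}.
  by rewrite (eq_parity _ _ crossesE); exact: (H _ p0).
have Hl : parity (se l) x s = false.
  have [_ <- _] := faces_agree (avoid0 l (mem_head _ _)).
  apply: parity_false => y z ys zs; have := allP sbox _ ys; have := allP sbox _ zs.
  rewrite /box /nw /ray -/(Re l) ln => hz hy; apply/negP => /and3P[_ _]; lia.
clear p0; elim: p l lp avoid0 Hl {ln} => [|w p IH] l /=.
  by move=> _ _ Hl v; rewrite inE => /eqP->.
move=> /andP[lw wp] av Hl.
have avw : {in w :: p, forall v, v \notin x :: s}.
  by move=> v vp; apply: av; rewrite inE vp orbT.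
suff Hw : parity (se w) x s = false.
  by move=> v; rewrite inE => /predU1P[->//|]; exact: IH.
have [l1 l2 l3] := faces_agree (av _ (mem_head _ _)).
have [w1 w2 w3] := faces_agree (avw _ (mem_head _ _)).
move: l1 l2 l3 w1 w2 w3; rewrite Hl.
move: lw; rewrite adjE !inE; case/or4P => /eqP->; rewrite /se /ne /nw /sw /= ?subrK ?addrK.
- by move=> -> _ _ _ <-.
- by move=> _ _ -> _ _ _ //.
- by move=> -> _ _ _ _ _.
- by move=> _ _ _ <-.
Qed.

End LoopParity.

(** The half-line descending from the square on the right of the step from [x]
    to [v]. *)
Definition right_face (x v : Z2) : rel Z2 :=
  if v == east x then se x else if v == west x then nw x
  else if v == north x then ne x else sw x.

Lemma right_faceE x : right_face x (east x) = se x.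
Proof. by rewrite /right_face eqxx. Qed.
Lemma right_faceW x : right_face x (west x) = nw x.
Proof. by rewrite /right_face eqxx ifF //; apply/negP; rewrite xpair_eqE /=; lia. Qed.
Lemma right_faceN x : right_face x (north x) = ne x.
Proof.
by rewrite /right_face eqxx ifF ?ifF //; apply/negP; rewrite xpair_eqE /=; lia.
Qed.
Lemma right_faceS x : right_face x (south x) = sw x.
Proof.
by rewrite /right_face ifF ?ifF ?ifF //; apply/negP; rewrite xpair_eqE /=; lia.
Qed.

Lemma adjV x y : adj x y -> [\/ y = east x, y = west x, y = north x | y = south x].
Proof.
rewrite adjE !inE; case/or4P => /eqP->;
  by [constructor 1|constructor 2|constructor 3|constructor 4].
Qed.

Lemma dirs_neq v : [/\ east v != v, west v != v, north v != v & south v != v].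
Proof. by case: v => a b; rewrite !xpair_eqE /=; split; lia. Qed.

Lemma dirsE v :
  [/\ (east v == west v) = false, (east v == north v) = false & (east v == south v) = false].
Proof. by case: v => a b; rewrite !xpair_eqE /=; split; lia. Qed.

Lemma dirsWNS v :
  [/\ (west v == north v) = false, (west v == south v) = false & (north v == south v) = false].
Proof. by case: v => a b; rewrite !xpair_eqE /=; split; lia. Qed.

Section Turn.
Variables (l : Z2) (p1 p2 : seq Z2) (v y : Z2).
Let s := p1 ++ v :: y :: p2.
Let x := last l p1.
Hypotheses (ls : path adj l s) (us : uniq (l :: s)).
Hypotheses (cl : v.1 != l.1) (cr : v.1 != (last l s).1).

Let xv : adj x v.
Proof. by move: ls; rewrite cat_path /= => /and3P[]. Qed.
Let vy : adj v y.
Proof. by move: ls; rewrite cat_path /= => /and4P[]. Qed.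

Let vp1 : v \notin l :: p1.
Proof.
by move: us; rewrite /s -cat_cons cat_uniq => /and3P[_ /hasPn/(_ v) + _]; apply; rewrite mem_head.
Qed.

Let vp2 : v \notin y :: p2.
Proof. by move: us; rewrite /s -cat_cons cat_uniq => /and3P[_ _ /= /andP[]]. Qed.

Let xy : x != y.
Proof.
have : y \notin l :: p1.
  move: us; rewrite /s -cat_cons cat_uniq => /and3P[_ /hasPn/(_ y) + _]; apply.
  by rewrite !inE eqxx orbT.
by apply: contraNneq => <-; exact: mem_last.
Qed.

Let edge_at z : z != v -> parity (edge v z) l s = (z == x) (+) (z == y).
Proof.
move=> zv; rewrite /s parity_cat /= parity_edge_notinl //.
rewrite [parity _ y p2]parity_edge_notinl // addbF /edge eqxx /=.
rewrite [v == z]eq_sym (negbTE zv) andbF andbT /=.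
by rewrite [_ == z]eq_sym [y == z]eq_sym orbF.
Qed.

(** Turning around [v] from the square on the right of the incoming step to
    the one on the right of the outgoing step crosses no other edge at [v] of
    the self-avoiding path. *)
Lemma turn : parity (right_face x v) l s = parity (right_face v y) l s.
Proof.
have [cl1 cl2] : column v.1 v.2 l = column v.1 v.2 (last l s) /\
    column v.1 (v.2 - 1) l = column v.1 (v.2 - 1) (last l s).
  by rewrite /column /Re ![_ == v.1]eq_sym (negbTE cl) (negbTE cr).
have [] := around ls cl1 cl2.
have [nE nW nN nS] := dirs_neq v.
rewrite !edge_at //.
have [EW EN ES] := dirsE v; have [WN WS NS] := dirsWNS v.
have WE : (west v == east v) = false by rewrite eq_sym.
have NE : (north v == east v) = false by rewrite eq_sym.
have SE : (south v == east v) = false by rewrite eq_sym.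
have NW : (north v == west v) = false by rewrite eq_sym.
have SW : (south v == west v) = false by rewrite eq_sym.
have SN : (south v == north v) = false by rewrite eq_sym.
have inW : right_face (west v) v = sw v.
  have {2}-> : v = east (west v) by case: (v) => a b; rewrite /east /west /= subrK.
  by rewrite right_faceE.
have inE' : right_face (east v) v = ne v.
  have {2}-> : v = west (east v) by case: (v) => a b; rewrite /east /west /= addrK.
  by rewrite right_faceW /nw /= addrK.
have inS : right_face (south v) v = se v.
  have {2}-> : v = north (south v) by case: (v) => a b; rewrite /north /south /= subrK.
  by rewrite right_faceN.
have inN : right_face (north v) v = nw v.
  have {2}-> : v = south (north v) by case: (v) => a b; rewrite /north /south /= addrK.
  by rewrite right_faceS /sw /= addrK.
have vx : adj v x by rewrite adjC.
move: xy; case: (adjV vx) => ->; case: (adjV vy) => ->; rewrite ?eqxx // => _;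
  rewrite ?inW ?inE' ?inS ?inN ?right_faceE ?right_faceW ?right_faceN ?right_faceS;
  rewrite ?eqxx ?EW ?EN ?ES ?WN ?WS ?NS ?WE ?NE ?SE ?NW ?SW ?SN /= ?addbF => h1 h2 h3 h4;
  congruence.
Qed.

End Turn.

Lemma parity_edge_once l p1 v p2 : uniq (l :: p1 ++ v :: p2) ->
  parity (edge (last l p1) v) l (p1 ++ v :: p2) = true.
Proof.
rewrite -cat_cons cat_uniq => /and3P[_ /hasPn d /= /andP[vp2 _]].
have vp1 : v \notin l :: p1 by apply: d; rewrite mem_head.
have xp2 : last l p1 \notin v :: p2.
  by apply/negP => /d; rewrite mem_last.
rewrite parity_cat /= parity_edge_notinr // parity_edge_notinl // /edge !eqxx.
by [].
Qed.

Section Crossing.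
Variables (n : nat) (l r : Z2) (t : seq Z2).
Let s := rcons t r.
Hypotheses (n_gt0 : (0 < n)%N) (ln : Re l = - n%:Z) (rn : Re r = n%:Z + 1).
Hypotheses (tbox : all (box n) t) (ls : path adj l s) (us : uniq (l :: s)).

Let Re_s z : z \in s -> Re z != - n%:Z.
Proof.
rewrite /s mem_rcons inE => /predU1P[->|/(allP tbox)]; first by rewrite rn; lia.
by rewrite /box; lia.
Qed.

Let ray_after (b : int) v p : {in v :: p, forall z, z \in s} -> parity (ray (- n%:Z) b) v p = false.
Proof.
move=> vs; apply: parity_false => y z /vs ys /vs zs; have := Re_s ys; have := Re_s zs.
by rewrite /ray => /negbTE-> /negbTE->; rewrite andbF /= !andbF.
Qed.

(** The path starts with a step to the right from [l], and [l] is its only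
    vertex on the side [Re = -n]: the half-line descending from below that step
    meets no step at all, so the parity starts at zero, and [turn] preserves
    it. *)
Lemma right_side p1 v p2 : s = p1 ++ v :: p2 ->
  parity (right_face (last l p1) v) l s = false.
Proof.
elim/last_ind: p1 v p2 => [|p1 u IH] v p2 /= sE.
  have vs z : z \in v :: p2 -> z \in s by rewrite sE.
  move: ls; rewrite sE /= => /andP[lv _].
  have v1 : v = east l.
    have : ~~ (Re v <= Re l).
      have := vs v (mem_head _ _); rewrite /s mem_rcons inE => /predU1P[->|/(allP tbox)].
        by rewrite rn ln; lia.
      by rewrite /box ln; lia.
    by case: (adjV lv) => ->; rewrite // /west /north /south /Re /=; lia.
  have -> : right_face l v = se l by rewrite v1 right_faceE.
  rewrite /se -/(Re l) ln ray_after // addbF.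
  by apply/negP => /and3P[_ + _]; rewrite /Im; lia.
have sE' : s = p1 ++ u :: v :: p2 by rewrite sE -cats1 -catA.
rewrite last_rcons; have := IH _ _ sE'; rewrite sE'.
have ut : u \in t.
  have : u \in belast l s.
    by rewrite sE' belast_cat mem_cat /= !inE eqxx ?orbT.
  rewrite /s belast_rcons inE => /predU1P[ul|//].
  by move: us; rewrite sE' /= mem_cat inE ul eqxx orbT.
have := allP tbox _ ut; rewrite /box => ub.
rewrite turn -?sE' //; first by rewrite -/(Re u) -/(Re l) ln; lia.
by rewrite /s last_rcons -/(Re u) -/(Re r) rn; lia.
Qed.

(** The square on the right of the step from [0] to [1] is the one from which
    the zipper descends. *)
Lemma crossing_parity01 p1 p2 : s = p1 ++ pt1 :: p2 -> last l p1 = pt0 ->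
  parity crosses l s = false.
Proof.
move=> sE lp; have := right_side sE; rewrite lp.
have -> : pt1 = east pt0 by [].
by rewrite right_faceE (eq_parity _ _ crossesE).
Qed.

(** The square on the right of the step from [1] to [0] lies above the edge,
    hence is separated from the zipper by that edge, used once. *)
Lemma crossing_parity10 p1 p2 : s = p1 ++ pt0 :: p2 -> last l p1 = pt1 ->
  parity crosses l s = true.
Proof.
move=> sE lp; have := right_side sE; rewrite lp.
have -> : pt0 = west pt1 by [].
rewrite right_faceW (eq_parity _ _ crossesE) /nw (rayV _ _ ls).
have -> : parity (edge (pt1.1 - 1, pt1.2) (pt1.1 - 1 + 1, pt1.2)) l s = true.
  have := us; rewrite {1}sE => /parity_edge_once; rewrite -sE lp => <-.
  by apply: eq_parity => y z; rewrite edgeC.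
by rewrite addbT => /negbFE.
Qed.

End Crossing.

(** * Chronological loop erasure *)
Section ChronologicalErasure.
Local Open Scope nat_scope.
Lemma last_visit_eq w x j : j < size w -> nth pt0 w j = x ->
  (forall k, j < k < size w -> nth pt0 w k != x) -> last_visit w x = j.
Proof.
move=> jw wj after; apply/eqP; rewrite eqn_leq; apply/andP; split.
  apply/bigmax_leqP => k /eqP wk; rewrite leqNgt; apply/negP => jk.
  by have := after k; rewrite jk ltn_ord wk eqxx => /(_ isT).
by apply: (@leq_bigmax_cond _ _ _ (Ordinal jw)); rewrite /= wj.
Qed.

Lemma last_visitP w x : x \in w ->
  [/\ last_visit w x < size w, nth pt0 w (last_visit w x) = x
    & forall k, last_visit w x < k < size w -> nth pt0 w k != x].
Proof.
move=> xw; have jw : index x w < size w by rewrite index_mem.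
have c0 : 0 < #|[pred j : 'I_(size w) | nth pt0 w j == x]|.
  by apply/card_gt0P; exists (Ordinal jw); rewrite inE /= nth_index.
have [j wjx jE] := eq_bigmax_cond (fun j : 'I_(size w) => j : nat) c0.
have lvE : last_visit w x = j := jE.
rewrite lvE; split=> // [|k /andP[jk kw]]; first exact/eqP.
apply/negP => wk; have := @leq_bigmax_cond _ (fun j : 'I_(size w) => nth pt0 w j == x)
  (fun j => j : nat) (Ordinal kw) wk.
by rewrite -/(last_visit w x) lvE /= leqNgt jk.
Qed.

Lemma index_mkseq (T : eqType) (f : nat -> T) x j m : j < m -> f j = x ->
  (forall i, i < j -> f i != x) -> index x (mkseq f m) = j.
Proof.
move=> jm fj before; apply/eqP; rewrite eqn_leq; apply/andP; split.
  rewrite leqNgt; apply/negP => /(before_find x) /=.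
  by rewrite nth_mkseq // fj eqxx.
rewrite leqNgt; apply/negP => ij.
have im : index x (mkseq f m) < m by apply: ltn_trans jm.
have := before _ ij; rewrite -(nth_mkseq x f im) nth_index ?eqxx //.
by rewrite -index_mem size_mkseq.
Qed.

(** The times of the erasure increase strictly until the path ends. *)
Lemma erasure_time_bnd v i : v != [::] ->
  (forall j, j < i -> erasure_time v j != steps v) ->
  i <= erasure_time v i <= steps v.
Proof.
case: v => // y v _; elim: i => [|i IH] before.
  by have [] := @last_visitP (y :: v) y (mem_head _ _).
have /andP[ei es] : i <= erasure_time (y :: v) i <= steps (y :: v).
  by apply: IH => j ji; apply: before; exact: ltnW.
have lt : erasure_time (y :: v) i < steps (y :: v).
  by rewrite ltn_neqAle es before.
set z := nth pt0 (y :: v) (erasure_time (y :: v) i).+1.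
have zv : z \in y :: v by rewrite mem_nth.
rewrite -[erasure_time _ _.+1]/(last_visit _ z).
have [a b c] := last_visitP zv; apply/andP; split; last by rewrite -ltnS.
rewrite ltnNge; apply/negP => le.
have e2 : (erasure_time (y :: v) i).+1 < size (y :: v) by [].
have := c (erasure_time (y :: v) i).+1.
by rewrite -/z eqxx e2 andbT ltnS (leq_trans le ei) => /(_ isT).
Qed.

Lemma erasure_stepsP v : v != [::] ->
  [/\ erasure_steps v < size v, erasure_time v (erasure_steps v) = steps v
    & forall j, j < erasure_steps v -> erasure_time v j != steps v].
Proof.
move=> v0.
have vs : steps v \in mkseq (erasure_time v) (size v).
  apply/negPn/negP => out.
  have no j : j < size v -> erasure_time v j != steps v.
    move=> jv; apply: contraNneq out => <-; apply/mapP; exists j => //.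
    by rewrite mem_iota.
  have sv : (size v).-1 < size v by case: (v) v0.
  have /andP[] : (size v).-1 <= erasure_time v (size v).-1 <= steps v.
    apply: erasure_time_bnd => // j jv; apply: no; exact: ltn_trans sv.
  rewrite /steps => h1 h2; have := no _ sv.
  by rewrite /steps eqn_leq h2 h1.
have es : erasure_steps v < size v by rewrite -[X in _ < X](size_mkseq (erasure_time v)) index_mem.
split=> // [|j js].
  by rewrite -(nth_mkseq 0 (erasure_time v) es) nth_index.
have jv := ltn_trans js es.
by rewrite -(nth_mkseq 0 _ jv); have := before_find 0 js => /= ->.
Qed.

Lemma nth_tail (x : Z2) u v j : nth pt0 (x :: u ++ v) ((size u).+1 + j) = nth pt0 v j.
Proof. by rewrite addSn /= nth_cat ltnNge leq_addr /= addKn. Qed.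

Section Split.
Variables (x : Z2) (u v : seq Z2).
Hypotheses (ux : last x u = x) (xv : x \notin v).
Let w := x :: u ++ v.

Let nth0 : nth pt0 w (size u) = x.
Proof.
rewrite /w -cat_cons nth_cat /= ltnS leqnn -[size u]/(size (x :: u)).-1.
by rewrite nth_last.
Qed.

Let time0 : erasure_time w 0 = size u.
Proof.
rewrite -[LHS]/(last_visit w x); apply: last_visit_eq; rewrite ?nth0 //.
  by rewrite /w /= size_cat ltnS leq_addr.
move=> k /andP[uk kw]; rewrite -(subnKC uk) nth_tail.
apply: contraNneq xv => <-; apply: mem_nth.
by rewrite ltn_subLR //; move: kw; rewrite /w /= size_cat addSn.
Qed.

Let visitE y : y \in v -> last_visit w y = (size u).+1 + last_visit v y.
Proof.
move=> yv; have [a b c] := last_visitP yv.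
apply: last_visit_eq; rewrite ?nth_tail //.
  by rewrite /w /= size_cat addSn ltnS ltn_add2l.
move=> k /andP[uk kw].
have uk' : (size u).+1 <= k by apply: leq_trans (ltnW uk); rewrite leq_addr.
rewrite -(subnKC uk') nth_tail; apply: c.
rewrite -(ltn_add2l (size u).+1) subnKC // uk /=.
by rewrite ltn_subLR //; move: kw; rewrite /w /= size_cat addSn.
Qed.

(** The loop erasure forgets the walk up to the last visit to the initial
    vertex, then starts afresh: this recursion is the only property of the
    chronological definition that matters below. *)
Lemma loop_erasure_split :
  loop_erasure w = x :: (if v is [::] then [::] else loop_erasure v).
Proof.
have sw : steps w = size u + size v by rewrite /steps /w /= size_cat.
have [v0|v0] := eqVneq v [::].
  rewrite /loop_erasure (_ : erasure_steps w = 0) /=; last first.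
    by apply: index_mkseq => //; rewrite time0 sw v0 addn0.
  by rewrite /mkseq /= -/(erasure_time w 0) time0 nth0 v0.
have [ks kt kb] := erasure_stepsP v0.
have timeS i : i <= erasure_steps v -> erasure_time w i.+1 = (size u).+1 + erasure_time v i.
  elim: i => [|i IH] ik.
    rewrite -[LHS]/(last_visit w (nth pt0 w (erasure_time w 0).+1)) time0.
    rewrite -[(size u).+1]addn0 nth_tail visitE ?addn0 //.
    by apply: mem_nth; case: (v) v0.
  rewrite -[LHS]/(last_visit w (nth pt0 w (erasure_time w i.+1).+1)) IH; last exact: ltnW.
  rewrite -addnS nth_tail visitE //; apply: mem_nth.
  have /andP[_ le] := @erasure_time_bnd v i v0 (fun j ji => kb j (ltn_trans ji ik)).
  have : erasure_time v i < steps v by rewrite ltn_neqAle le kb.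
  by rewrite /steps; case: (v) v0.
have esw : erasure_steps w = (erasure_steps v).+1.
  apply: index_mkseq.
  - by rewrite /w /= ltnS size_cat (leq_trans ks) ?leq_addl.
  - rewrite timeS // kt sw /steps; case: (v) v0 => //= y v' _.
    by rewrite addSnnS.
  - case=> [_|i ik].
      by rewrite time0 sw -[X in X != _]addn0 eqn_add2l eq_sym size_eq0.
    rewrite timeS 1?ltnW // sw; have := kb i ik; rewrite /steps.
    case: (v) v0 => //= y v' _; by rewrite addSnnS eqn_add2l eqSS.
have -> : loop_erasure w = x :: mkseq (fun i => nth pt0 w (erasure_time w i.+1)) (erasure_steps
  v).+1.
  rewrite /loop_erasure esw -[in RHS]nth0 -[in RHS]time0 /mkseq.
  by rewrite -[iota 0 _.+2]/(0 :: iota (1 + 0) _.+1) iotaDl map_cons -map_comp.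
have -> : (if v is [::] then [::] else loop_erasure v) = loop_erasure v by case: (v) v0.
congr cons; apply/eq_in_map => i; rewrite mem_iota add0n ltnS => ik.
by rewrite timeS // nth_tail.
Qed.

End Split.

Lemma split_last (T : eqType) (x : T) s : exists u v, [/\ s = u ++ v, last x u = x & x \notin v].
Proof.
elim/last_ind: s => [|s y [u [v [-> ux xv]]]]; first by exists [::], [::].
have [->|yx] := eqVneq y x.
  by exists (rcons (u ++ v) x), [::]; rewrite cats0 last_rcons.
by exists u, (rcons v y); rewrite rcons_cat mem_rcons inE eq_sym negb_or yx.
Qed.

Lemma split_last_uniq (T : eqType) (x : T) u v u' v' :
  last x u = x -> x \notin v -> last x u' = x -> x \notin v' ->
  u ++ v = u' ++ v' -> u = u' /\ v = v'.
Proof.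
wlog le : u v u' v' / size u <= size u'.
  move=> H; case: (leqP (size u) (size u')); first exact: H.
  by move=> /ltnW le a b c d e; have [] := H u' v' u v le c d a b (esym e).
move=> ux xv ux' xv' e; suff se : size u' = size u.
  by move/eqP: e; rewrite eqseq_cat // => /andP[/eqP-> /eqP->].
apply/eqP; rewrite eqn_leq le andbT leqNgt; apply/negP => lt.
have E : u' = u ++ take (size u' - size u) v.
  have := congr1 (take (size u')) e; rewrite [take _ (u' ++ v')]take_size_cat // take_cat.
  by rewrite ltnNge le /= => ->.
move: ux'; rewrite E last_cat ux.
have : take (size u' - size u) v != [::].
  rewrite -size_eq0 size_take; have := congr1 size e; rewrite !size_cat => se.
  case: ltnP => _; rewrite -lt0n; lia.
case tE: (take _ v) => [//|y t] _ /= ty.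
have : x \in take (size u' - size u) v by rewrite tE -{1}ty mem_last.
by move=> /mem_take; rewrite (negbTE xv).
Qed.

End ChronologicalErasure.

(** * Fibres of the loop erasure *)
Lemma esumZl (R : realType) (T : choiceType) (S : set T) (c : R) (f : T -> \bar R) :
  0 <= c -> (forall i, (0 <= f i)%E) ->
  (\esum_(i in S) (c%:E * f i) = c%:E * \esum_(i in S) f i)%E.
Proof.
move=> c0 f0.
have le (d : R) (g : T -> \bar R) : 0 <= d -> (forall i, (0 <= g i)%E) ->
    (\esum_(i in S) (d%:E * g i) <= d%:E * \esum_(i in S) g i)%E.
  move=> d0 g0; apply: ge_ereal_sup => _ [X XS <-].
  rewrite -ge0_mule_fsumr //.
  by apply: lee_wpmul2l; rewrite ?lee_fin //; apply: esum_ge; exists X.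
apply/eqP; rewrite eq_le le //=.
have [->|cn0] := eqVneq c 0.
  by rewrite mul0e; apply: esum_ge0 => i _; rewrite mul0e.
have {cn0}c0 : 0 < c by rewrite lt_neqAle eq_sym cn0.
have cV0 : 0 <= c^-1 by rewrite invr_ge0 ltW.
have cf0 i : (0 <= c%:E * f i)%E by rewrite mule_ge0 // lee_fin ltW.
have := lee_wpmul2l (ltW (c0 : (0 < c%:E)%E)) (le _ _ cV0 cf0).
rewrite muleA -EFinM divff ?gt_eqF // mul1e; apply: le_trans.
apply: lee_wpmul2l; first by rewrite lee_fin ltW.
by apply: le_esum => i _; rewrite muleA -EFinM mulVf ?gt_eqF // mul1e.
Qed.

Lemma esum_prod (R : realType) (T1 T2 : choiceType) (A : set T1) (B : set T2)
    (f : T1 -> R) (g : T2 -> R) (a b : R) :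
  (forall x, 0 <= f x) -> (forall x, 0 <= g x) ->
  \esum_(x in A) (f x)%:E = a%:E -> \esum_(x in B) (g x)%:E = b%:E ->
  \esum_(p in A `*` B) (f p.1 * g p.2)%:E = (a * b)%:E.
Proof.
move=> f0 g0 fa gb.
have -> : A `*` B = A `*`` (fun _ => B) by [].
rewrite -(@esum_esum _ _ _ _ _ (fun x y => (f x * g y)%:E)); last first.
  by move=> x y _ _; rewrite lee_fin mulr_ge0.
under eq_esum => x _.
  under eq_esum do rewrite EFinM.
  rewrite esumZl // gb -EFinM mulrC EFinM.
  over.
have b0 : 0 <= b by rewrite -lee_fin -gb; apply: esum_ge0 => x _; rewrite lee_fin.
by rewrite esumZl ?fa -?EFinM 1?mulrC.
Qed.

Section NonnegWalks.
Variables (R : realType) (N : nat) (P : 'M[R]_N).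
Hypotheses (Psub : subcritical P) (Psym : P^T = P) (P0 : forall i j, 0 <= P i j).
Implicit Types (D : {set 'I_N}) (c : 'I_N -> R).

Lemma path_weight_ge0 x s : 0 <= path_weight P x s.
Proof. by elim: s x => //= y s IH x; rewrite mulr_ge0. Qed.

Lemma esum_walk D c x : (forall y, 0 <= c y) ->
  \esum_(s in [set s | all (mem D) s]) (path_weight P x s * c (last x s))%:E =
    (exit_sum P D c x)%:E.
Proof.
move=> c0; rewrite (@esum_size _ _ (all (mem D)) (fun s => (path_weight P x s *
  c (last x s))%:E)); last first.
  by move=> s; rewrite lee_fin mulr_ge0 // path_weight_ge0.
rewrite -(@nneseries_cvg _ (fun k => walk_sum P D c k x)) //.
- by apply: eq_eseriesr => k _; rewrite sumEFin.
- by move=> k; apply: sumr_ge0 => t _; rewrite mulr_ge0 // path_weight_ge0.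
- exact: cvg_walk_sum.
Qed.

(** The loops at [x] in [D] sum to the diagonal Green function. *)
Lemma esum_loops D x : x \in D ->
  \esum_(s in [set s | all (mem D) s && (last x s == x)]) (path_weight P x s)%:E =
  (lap_det P (D :\ x) / lap_det P D)%:E.
Proof.
have dt0 := lap_det_neq0 Psub Psym.
move=> xD; rewrite -green_diag //.
have -> : green P D x x = exit_sum P D (fun y => (y == x)%:R) x.
  rewrite -hit_sum_eq // /hit_sum (bigD1 x) //= eqxx mulr1 big1 ?addr0 //.
  by move=> y /andP[_ /negbTE->]; rewrite mulr0.
rewrite -esum_walk; last by move=> y; case: eqP.
rewrite (_ : [set s | _] = [set s | all (mem D) s] `&` [set s | last x s == x]).
  rewrite esum_mkcondr; apply: eq_esum => s _.
  case: ifPn => [/set_mem /= ->|/negP h]; first by rewrite mulr1.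
  by case: eqP h => [e|_ _]; [case; rewrite inE /= e | rewrite mulr0].
by apply/seteqP; split=> s /=; [move/andP|move=> [-> ->]].
Qed.

End NonnegWalks.

Section Erasure.
Variables (n : nat) (R : realType).
Local Notation I := 'I_(box_size n).
Local Notation P := (walk_mx n R).
Let Psub := walk_mx_subcritical n R.
Let Psym := walk_mx_sym n R.
Implicit Types (D : {set I}) (s u v e : seq I) (F : I -> R).

Variable r : Z2.
Hypothesis rbox : ~~ box n r.

(** Walks are recorded by their vertices inside the box.  The exit point [r] is
    kept apart because it lies outside the box. *)
Definition exit_path s : seq Z2 := rcons (map (@vtx n) s) r.

(** The weight of a walk [s] whose first vertex is reached with weight [F]. *)
Definition entry_weight F s : R := if s is y :: s' then F y * path_weight P y s' else 1.

Lemma entry_weight_ge0 F s : (forall x, 0 <= F x) -> 0 <= entry_weight F s.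
Proof.
move=> F0; case: s => //= y s; rewrite mulr_ge0 // path_weight_ge0 // => i j.
exact: walk_mx_ge0.
Qed.

Lemma path_weight_cat x s v : path_weight P x (s ++ v) =
  path_weight P x s * path_weight P (last x s) v.
Proof. by elim: s x => [|y s IH] x /=; rewrite ?mul1r // IH mulrA. Qed.

Lemma path_weightE x v : path_weight P x v = entry_weight (P x) v.
Proof. by case: v. Qed.

Lemma exit_path_erasure x u v : last x u = x -> x \notin v ->
  loop_erasure (exit_path (x :: u ++ v)) = vtx x :: loop_erasure (exit_path v).
Proof.
move=> ux xv; rewrite /exit_path /= map_cat rcons_cat loop_erasure_split ?last_map ?ux //.
  by case: (v).
rewrite mem_rcons inE negb_or (mem_map (@vtx_inj n)) xv andbT.
by apply: contraNneq rbox => <-; rewrite box_vtx.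
Qed.

Lemma exit_path_erasure_nil : loop_erasure (exit_path [::]) = [:: r].
Proof. by rewrite /exit_path -[rcons _ _]/(r :: [::] ++ [::]) loop_erasure_split. Qed.

Definition erasure_fiber D e : set (seq I) :=
  [set s | all (mem D) s && (loop_erasure (exit_path s) == exit_path e)].

Lemma erasure_fiber_nil D : erasure_fiber D [::] = [set [::]].
Proof.
apply/seteqP; split=> s; rewrite /erasure_fiber /=; last first.
  by move=> ->; rewrite exit_path_erasure_nil eqxx.
case: s => // x s /andP[_]; have [u [v [-> ux xv]]] := split_last x s.
rewrite exit_path_erasure // /exit_path /= => /eqP[xr].
by move: rbox; rewrite -xr box_vtx.
Qed.

(** A walk that erases to [x :: e] is a loop at [x] followed by a walk that
    avoids [x] and erases to [e]. *)
Lemma erasure_fiber_cons D x e : x \in D ->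
  set_bij ([set u | all (mem D) u && (last x u == x)] `*` erasure_fiber (D :\ x) e)
    (erasure_fiber D (x :: e)) (fun p => x :: p.1 ++ p.2).
Proof.
move=> xD; have out v : all (mem (D :\ x)) v -> x \notin v.
  by move=> /allP vD; apply/negP => /vD; rewrite /= in_setD1 eqxx.
have sub v : all (mem (D :\ x)) v -> all (mem D) v.
  by move=> /allP vD; apply/allP => y /vD /=; rewrite in_setD1 => /andP[].
split=> [[u v] [/= /andP[uD /eqP ux] /andP[vD /eqP tailE]]||s].
- rewrite /erasure_fiber /= xD all_cat uD sub //= exit_path_erasure ?out // tailE.
  by rewrite /exit_path.
- move=> [u v] [u' v'] /set_mem[/= /andP[_ /eqP ux] /andP[vD _]].
  move=> /set_mem[/= /andP[_ /eqP ux'] /andP[vD' _]] [e'].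
  by have [-> ->] := split_last_uniq ux (out _ vD) ux' (out _ vD') e'.
- rewrite /erasure_fiber /=; case: s => [|y s].
    rewrite exit_path_erasure_nil /exit_path /= => /eqP[rx _].
    by move: rbox; rewrite rx box_vtx.
  have [u [v [-> uy yv]]] := split_last y s; rewrite exit_path_erasure // => /andP[].
  rewrite /exit_path /= => /andP[yD]; rewrite all_cat => /andP[uD vD] /eqP[/vtx_inj yx tailE].
  subst y; exists (u, v) => //=; split=> /=; first by rewrite uD uy eqxx.
  rewrite /erasure_fiber /= tailE eqxx andbT; apply/allP => z zv /=.
  rewrite in_setD1 [z \in D](allP vD) // andbT.
  by apply: contraNneq yv => <-.
Qed.

(** Each vertex of [e] contributes its loops in what remains of [D], a
    quotient of two consecutive determinants, and the product telescopes. *)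
Lemma esum_erasure_fiber D e F : (forall x, 0 <= F x) -> uniq e -> all (mem D) e ->
  \esum_(s in erasure_fiber D e) (entry_weight F s)%:E =
  (entry_weight F e * (lap_det P (avoid D e) / lap_det P D))%:E.
Proof.
have P0 := @walk_mx_ge0 n R; have dt0 := lap_det_neq0 Psub Psym.
elim: e D F => [|x e IH] D F F0 /=.
  move=> _ _; rewrite erasure_fiber_nil esum_set1 ?lee_fin //=.
  by rewrite avoid_nil divff ?dt0 // mulr1.
move=> /andP[xe ue] /andP[xD eD].
rewrite (reindex_esum _ _ _ _ (erasure_fiber_cons e xD)).
have eDx : all (mem (D :\ x)) e.
  apply/allP => y ye /=; rewrite in_setD1 [y \in D](allP eD) // andbT.
  by apply: contraNneq xe => <-.
transitivity (\esum_(p in [set u | all (mem D) u && (last x u == x)] `*` erasure_fiber (D :\ x) e)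
    ((F x * path_weight P x p.1) * entry_weight (P x) p.2)%:E).
  apply: eq_esum => -[u v] [/= /andP[_ /eqP ux] _].
  by rewrite path_weight_cat ux (path_weightE x v) mulrA.
rewrite (@esum_prod _ _ _ _ _ (fun u => F x * path_weight P x u) (entry_weight (P x))
  (F x * (lap_det P (D :\ x) / lap_det P D)) (entry_weight (P x) e *
    (lap_det P (avoid (D :\ x) e) / lap_det P (D :\ x)))).
- congr EFin; rewrite avoid_cons path_weightE; field.
  by rewrite !dt0.
- by move=> u; rewrite mulr_ge0 // path_weight_ge0.
- by move=> v; rewrite entry_weight_ge0.
- under eq_esum do rewrite EFinM.
  rewrite esumZl //; last by move=> u; rewrite lee_fin path_weight_ge0.
  by rewrite esum_loops // EFinM.
- by rewrite IH.
Qed.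

Lemma erasure_fiber_inv D s x e : s \in erasure_fiber D (x :: e) ->
  exists u v, [/\ s = x :: u ++ v, last x u = x & v \in erasure_fiber [set: I]%SET e].
Proof.
rewrite inE /erasure_fiber /= => /andP[_]; case: s => [|y s].
  rewrite exit_path_erasure_nil /exit_path /= => /eqP[rx _].
  by move: rbox; rewrite rx box_vtx.
have [u [v [-> uy yv]]] := split_last y s; rewrite exit_path_erasure // => /eqP tailE.
have yx : y = x by apply: vtx_inj; case: tailE.
subst y; exists u, v; split=> //; rewrite inE /erasure_fiber /=; apply/andP; split.
  by apply/allP => w _ /=; rewrite inE.
by apply/eqP; have := congr1 behead tailE.
Qed.

Lemma erasure_fiber_last D s x e : s \in erasure_fiber D (x :: e) ->
  exists2 s', s = x :: s' & last x s' = last x e.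
Proof.
elim: e D s x => [|z e IH] D s x /erasure_fiber_inv[u [v [-> ux]]].
  by rewrite erasure_fiber_nil inE /= => ->; exists u; rewrite ?cats0.
by move=> /IH[v' -> lv]; exists (u ++ z :: v') => //; rewrite last_cat.
Qed.

End Erasure.

(** * Paths through the central edge *)
Section PathSums.
Variables (n : nat) (n_gt0 : (0 < n)%N) (R : realType).
Local Notation I := 'I_(box_size n).
Local Notation P := (walk_mx n R).
Local Notation vtx_idx := (vtx_idx n_gt0).
Local Notation i0 := (vtx_idx pt0).
Local Notation i1 := (vtx_idx pt1).
Local Notation exL := (@exit_left n R).
Local Notation exR := (@exit_right n R).
Local Notation exit_path := (@exit_path n).
Local Notation D01 := (off01 n).
Let Psub := walk_mx_subcritical n R.
Let Psym := walk_mx_sym n R.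

Lemma path_weight_walk x s :
  path_weight P x s = if path adj (vtx x) (map (@vtx n) s) then 4^-1 ^+ size s else 0.
Proof.
elim: s x => [|y s IH] x //=; rewrite IH mxE.
by case: ifP => _; case: ifP => _ //=; rewrite ?mul0r ?mulr0 ?exprS.
Qed.

Lemma exit_adjL (l : Z2) (i : I) : Re l = - n%:Z -> adj l (vtx i) ->
  Re (vtx i) = 1 - n%:Z /\ l = west (vtx i).
Proof.
move=> ln la; have := box_vtx i; rewrite /box => bi.
case: (adjV la) => e; move: bi; rewrite e /east /west /north /south /Re /= in ln * => bi;
  try by exfalso; lia.
split; first by lia.
by rewrite addrK; case: (l).
Qed.

Lemma exit_adjR (r : Z2) (i : I) : Re r = n%:Z + 1 -> adj (vtx i) r ->
  Re (vtx i) = n%:Z /\ r = east (vtx i).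
Proof.
move=> rn ar; have := box_vtx i; rewrite /box => bi.
rewrite adjC in ar.
case: (adjV ar) => e; move: bi; rewrite e /east /west /north /south /Re /= in rn * => bi;
  try by exfalso; lia.
split; first by lia.
by rewrite subrK; case: (r).
Qed.

Lemma adj_vW v : adj (west v) v.
Proof. by rewrite adjC adjE !inE /west eqxx orbT. Qed.

Lemma adj_vE v : adj v (east v).
Proof. by rewrite adjE !inE /east eqxx. Qed.

Lemma out_left l : Re l = - n%:Z -> ~~ box n l.
Proof. by rewrite /box => ->; rewrite ltxx. Qed.

Lemma out_right r : Re r = n%:Z + 1 -> ~~ box n r.
Proof. by rewrite /box => ->; rewrite ltxx andbF. Qed.

Lemma map_vtx_idx t : all (box n) t -> t = map (@vtx n) (map vtx_idx t).
Proof. by elim: t => //= z t IH /andP[bz /IH <-]; rewrite vtx_idxK. Qed.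

Lemma all_box_vtx s : all (box n) (map (@vtx n) s).
Proof. by apply/allP => _ /mapP[i _ ->]; exact: box_vtx. Qed.

Lemma inner_rcons (l r : Z2) t : inner (l :: rcons t r) = t.
Proof. by rewrite /inner /steps /= size_rcons /= -cats1 take_size_cat. Qed.

Lemma pathK_exit_path l s r : pathK n (l :: exit_path r s) =
  [&& path adj l (exit_path r s), Re l == - n%:Z & Re r == n%:Z + 1].
Proof.
rewrite /pathK /nnpath /= /exit_path inner_rcons all_box_vtx andbT.
by rewrite /finish /= last_rcons.
Qed.

Lemma pathKP w : pathK n w -> exists l s r, w = l :: exit_path r s.
Proof.
case: w => // l w; case/lastP: w => [|t r].
  by move=> /and4P[_ /eqP]; rewrite /start /finish /= => -> /eqP; lia.
rewrite /pathK inner_rcons => /and4P[_ _ _ /map_vtx_idx tE].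
by exists l, (map vtx_idx t), r; rewrite /exit_path -tE.
Qed.

Lemma exit_path_inj (r r' : Z2) e e' : exit_path r e = exit_path r' e' -> r = r' /\ e = e'.
Proof. by move=> /rcons_inj[/(inj_map (@vtx_inj n)) -> ->]. Qed.

Lemma erasure_exit_path r s : ~~ box n r -> exists e, loop_erasure (exit_path r s) = exit_path r e.
Proof.
move=> rb; have [m] := ubnP (size s); elim: m s => // m IH [|x s] sm.
  by exists [::]; rewrite exit_path_erasure_nil.
have [u [v [sE ux xv]]] := split_last x s.
have [|e eE] := IH v; first by move: sm; rewrite sE /= size_cat; lia.
by exists (x :: e); rewrite sE exit_path_erasure // eE.
Qed.

Lemma erasure_left l r s : Re l = - n%:Z -> Re r = n%:Z + 1 ->
  loop_erasure (l :: exit_path r s) = l :: loop_erasure (exit_path r s).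
Proof.
move=> ln rn; rewrite -[exit_path r s]cat0s loop_erasure_split //.
  by rewrite cat0s /exit_path; case: (map _ s).
rewrite mem_rcons inE negb_or; apply/andP; split.
  by apply/eqP => lr; move: ln; rewrite lr rn; lia.
by apply/mapP => -[i _ li]; have := out_left ln; rewrite li box_vtx.
Qed.

(** The leading [4^-1] is the weight of the final step to [r].  Index
    sequences that are not nearest neighbour paths have weight zero, so they
    may be included in the sum over the fibre. *)
Lemma phat_eq l r e : pathK n (l :: exit_path r e) -> uniq e ->
  phat R n (l :: exit_path r e) =
  (4^-1 * entry_weight exL e * (lap_det P (avoid [set: I]%SET e) / lap_det P [set: I]%SET))%:E.
Proof.
rewrite pathK_exit_path => /and3P[pe /eqP ln /eqP rn] ue.
have rb := out_right rn.
have exitL0 x : 0 <= exL x by rewrite /exit_left; case: ifP.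
pose G := [set s : seq I | path adj l (exit_path r s)].
have -> : phat R n (l :: exit_path r e) =
    \esum_(s in erasure_fiber r [set: I]%SET e `&` G) (weight R (l :: exit_path r s))%:E.
  apply: reindex_esum; split.
  - move=> s [/= /andP[_ /eqP sE] sG] /=; rewrite pathK_exit_path ln rn !eqxx sG.
    by split=> //; rewrite erasure_left // sE.
  - by move=> s s' _ _ [/exit_path_inj[]].
  - move=> w [/= wK]; have [l' [s [r' wE]]] := pathKP wK; move: wK; rewrite wE.
    rewrite pathK_exit_path => /and3P[pw' /eqP ln' /eqP rn'].
    rewrite erasure_left // => -[ll sE]; subst l'.
    have [e' eE] := erasure_exit_path s (out_right rn'); move: sE; rewrite eE.
    move=> /exit_path_inj[rr ee]; subst r' e'; exists s => //; split=> //.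
    by rewrite /erasure_fiber /= eE eqxx andbT; apply/allP => i _ /=; rewrite inE.
rewrite esum_mkcondr -mulrA EFinM -(esum_erasure_fiber rb) //; last first.
  by apply/allP => i _ /=; rewrite inE.
rewrite -esumZl //; last by move=> s; rewrite lee_fin entry_weight_ge0.
apply: eq_esum => s sF.
case: e pe {ue} sF => [|x e].
  rewrite /exit_path /= andbT => /adjV adjlr; exfalso.
  case: adjlr ln => e; move: rn; rewrite e /east /west /north /south /Re /=; lia.
rewrite /exit_path /= rcons_path => /and3P[lx _ er] /mem_set sF.
have [s' sE ls] := erasure_fiber_last rb sF.
have -> : (s \in G) = path adj (vtx x) (map (@vtx n) s').
  apply/idP/idP; rewrite sE inE /G /exit_path /= lx /= rcons_path; first by case/andP.
  by move=> ->; rewrite last_map ls -last_map er.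
rewrite sE /= path_weight_walk /weight /steps /exit_path /= size_rcons size_map.
rewrite /exit_left; have [-> _] := exit_adjL ln lx; rewrite eqxx -EFinM.
by case: ifP => _; rewrite ?mulr0 // !exprS.
Qed.

Lemma exit_left_ge0 x : 0 <= exL x.
Proof. by rewrite /exit_left; case: ifP. Qed.

Lemma exit_right_ge0 x : 0 <= exR x.
Proof. by rewrite /exit_right; case: ifP. Qed.

Lemma sorted_rev_adj w : sorted adj (rev w) = sorted adj w.
Proof.
rewrite rev_sorted; apply: eq_sorted => x y; exact: adjC.
Qed.

(** Reversal of paths: [R_n] counts walks from the left side to [0], whereas
    [exit_sum] starts from [0]. *)
Lemma Rn_eq : Rn R n = (exit_sum P (slit n) exL i0)%:E.
Proof.
have lastE s : last pt0 (map (@vtx n) s) = vtx (last i0 s).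
  by rewrite -[in LHS](vtx_i0 n_gt0) last_map.
rewrite -(esum_walk Psub Psym (@walk_mx_ge0 n R)); last exact: exit_left_ge0.
pose G := [set s : seq I | path adj pt0 (map (@vtx n) s) && (Re (vtx (last i0 s)) == 1 - n%:Z)].
pose w s := rev (rcons (pt0 :: map (@vtx n) s) (west (vtx (last i0 s)))).
have wE s : w s = west (vtx (last i0 s)) :: rcons (rev (map (@vtx n) s)) pt0.
  by rewrite /w rev_rcons rev_cons.
have -> : Rn R n = \esum_(s in [set s | all (mem (slit n)) s] `&` G) (weight R (w s))%:E.
  apply: reindex_esum; split.
  - move=> s [/= sS /andP[sG /eqP ls]]; rewrite /pathK' /nnpath /w sorted_rev_adj.
    rewrite /= rcons_path sG lastE adjC adj_vW -/(w s) wE inner_rcons /=.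
    rewrite /start /finish /= last_rcons eqxx /=.
    apply/andP; split; first by move: ls; rewrite /Re; lia.
    rewrite all_rev all_map; apply/allP => i /(allP sS) /=.
    by rewrite inE box_vtx.
  - move=> s s' _ _; rewrite !wE => -[_ _ /rcons_inj[/(can_inj revK)]].
    by move=> /(inj_map (@vtx_inj n)).
  - case=> // l t; case/lastP: t => [|t r].
      move=> /and4P[_ /eqP + /eqP]; rewrite /start /finish /= => + l0.
      by rewrite l0 /Re /=; lia.
    move=> /= /and4P[+ /eqP]; rewrite /start /finish inner_rcons /= last_rcons.
    move=> tp ln /eqP r0 tb; subst r; rewrite /=.
    have tbox : all (box n) t by apply: sub_all tb => z /andP[].
    pose s := rev (map vtx_idx t).
    have sE : map (@vtx n) s = rev t by rewrite map_rev -map_vtx_idx.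
    move: tp; rewrite /nnpath /= -[path _ _ _]/(sorted adj (l :: rcons t pt0)).
    rewrite -sorted_rev_adj rev_cons rev_rcons /= rcons_path -sE lastE.
    rewrite adjC => /andP[ps al]; have [ls lE] := exit_adjL ln al.
    exists s; last by rewrite wE sE revK -lE.
    split; last by apply/andP; split=> //; exact/eqP.
    apply/allP => i; rewrite mem_rev => /mapP[z zt ->] /=.
    by have /andP[bz hz] := allP tb z zt; rewrite inE vtx_idxK.
rewrite esum_mkcondr; apply: eq_esum => s sS.
rewrite path_weight_walk (vtx_i0 n_gt0) /exit_left wE /weight /steps /= size_rcons size_rev
  size_map.
rewrite (_ : (s \in G) = path adj pt0 (map (@vtx n) s) && (Re (vtx (last i0 s)) == 1 - n%:Z)).
  by case: (path _ _ _) => /=; case: ifP => _; rewrite ?mul0r ?mulr0 ?exprSr.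
by apply/idP/idP; rewrite inE.
Qed.

Lemma in_off01 i : (i \in D01) = (i != i0) && (i != i1).
Proof.
by rewrite inE -!(inj_eq (@vtx_inj n)) !vtx_i0 !vtx_i1.
Qed.

Lemma entry_weight_rev (F : I -> R) a s v :
  entry_weight F (rev (a :: s) ++ v) = F (last a s) * path_weight P a s * path_weight P a v.
Proof.
elim: s a v => [|c s IH] a v; first by rewrite /rev /= mulr1.
rewrite rev_cons cat_rcons IH /= -!mulrA; congr (_ * _).
have -> : P c a = P a c by rewrite -{1}Psym mxE.
by rewrite mulrCA.
Qed.

Definition pairs (D : {set I}) : seq (seq I * seq I) :=
  [seq (s, t) | s <- uniq_seqs D, t <- uniq_seqs (avoid D s)].

Lemma mem_pairs D p : (p \in pairs D) = uniq (p.1 ++ p.2) && all (mem D) (p.1 ++ p.2).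
Proof.
case: p => s t /=.
transitivity ((s \in uniq_seqs D) && (t \in uniq_seqs (avoid D s))).
  apply/allpairsPdep/andP; first by move=> [s' [t' [? ? [-> ->]]]].
  by move=> [? ?]; exists s, t.
rewrite !mem_uniq_seqs cat_uniq all_cat -!andbA; case: (uniq s) => //=.
have -> : all (mem (avoid D s)) t = ~~ has (mem s) t && all (mem D) t.
  rewrite -all_predC -all_predI; apply: eq_all => i /=.
  by rewrite inE andbC.
case: (all (mem D) s) => /=; case: (has _ t) => //=; rewrite ?andbF //.
Qed.

Lemma uniq_pairs D : uniq (pairs D).
Proof.
apply: allpairs_uniq_dep; [exact: uniq_uniq_seqs|by move=> s _; exact: uniq_uniq_seqs|].
by move=> [s t] [s' t'] _ _ /= [-> ->].
Qed.

Section Joined.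
Variables a b : I.
Hypothesis ab : (a, b) = (i0, i1) \/ (a, b) = (i1, i0).

(** A pair of disjoint paths from [a] and from [b], read as one path from the
    end of the first to the end of the second through the edge [ab]. *)
Definition joined (p : seq I * seq I) : seq I := rev (a :: p.1) ++ b :: p.2.

(** The joined path extended by one horizontal step at each end, to the two
    vertical sides. *)
Definition spine (p : seq I * seq I) : seq Z2 :=
  west (vtx (last a p.1)) :: exit_path (east (vtx (last b p.2))) (joined p).

Let i01 : i0 != i1.
Proof. by rewrite -(inj_eq (@vtx_inj n)) vtx_i0 vtx_i1. Qed.

Let adj_ab : adj (vtx a) (vtx b).
Proof. by case: ab => -[-> ->]; rewrite vtx_i0 vtx_i1. Qed.

Let in_D01 i : (i \in D01) = (i != a) && (i != b).
Proof. by rewrite in_off01; case: ab => -[-> ->]; rewrite // andbC. Qed.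

Let neq_ab : a != b.
Proof. by case: ab => -[-> ->]; rewrite // eq_sym. Qed.

Lemma uniq_joined p : uniq (joined p) = (p \in pairs D01).
Proof.
rewrite mem_pairs /joined; set q := p.1 ++ p.2.
have /perm_uniq -> : perm_eq (rev (a :: p.1) ++ b :: p.2) (a :: b :: q).
  by apply/permP => c; rewrite /q count_cat count_rev /= count_cat; lia.
rewrite /= inE negb_or neq_ab /= andbA [RHS]andbC; congr (_ && _).
elim: q => //= i q <-; rewrite [i \in D01]in_D01 !inE !negb_or.
by rewrite ![i == _]eq_sym; do 2!case: (_ == i); case: (_ \in q); rewrite ?andbF.
Qed.

Lemma avoid_joined p : avoid [set: I]%SET (joined p) = avoid D01 (p.1 ++ p.2).
Proof.
have av D s i : (i \in avoid D s) = (i \in D) && (i \notin s) by rewrite inE.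
apply/setP => i; rewrite !av in_D01 finset.in_setT /joined mem_cat mem_rev !in_cons mem_cat.
rewrite !negb_or.
by do 2!case: (i == _); rewrite ?andbF ?andbT.
Qed.

Definition joined_path p : bool :=
  [&& Re (vtx (last a p.1)) == 1 - n%:Z, Re (vtx (last b p.2)) == n%:Z,
      path adj (vtx a) (map (@vtx n) p.1) & path adj (vtx b) (map (@vtx n) p.2)].

Lemma pathK_spine p : pathK n (spine p) = joined_path p.
Proof.
rewrite /spine pathK_exit_path /joined_path; set l := west _; set r := east _.
have -> : (Re l == - n%:Z) = (Re (vtx (last a p.1)) == 1 - n%:Z).
  by rewrite /l /west /Re /=; lia.
have -> : (Re r == n%:Z + 1) = (Re (vtx (last b p.2)) == n%:Z).
  by rewrite /r /east /Re /=; lia.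
rewrite andbC -andbA; do 2!congr (_ && _).
rewrite /exit_path /joined map_cat rcons_cat cat_path; congr (_ && _).
  rewrite -[path _ _ _]/(sorted adj (l :: map (@vtx n) (rev (a :: p.1)))).
  rewrite -sorted_rev_adj rev_cons map_rev revK /= rcons_path last_map /l.
  by rewrite adjC adj_vW andbT.
by rewrite rev_cons map_rcons last_rcons /= adj_ab rcons_path last_map /r adj_vE andbT.
Qed.

Lemma infix_spine p : infix [:: vtx a; vtx b] (spine p).
Proof.
apply/infixP; exists (west (vtx (last a p.1)) :: map (@vtx n) (rev p.1)).
exists (exit_path (east (vtx (last b p.2))) p.2).
rewrite /spine /joined /exit_path rev_cons cat_rcons map_cat /= rcons_cat /=.
by [].
Qed.

Lemma spine_inj : {in pairs D01 &, injective spine}.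
Proof.
move=> [s t] [s' t']; rewrite -!uniq_joined => us us' [_ _ /exit_path_inj[_]].
have bX q : uniq (joined q) -> b \notin rev (a :: q.1).
  by rewrite /joined cat_uniq => /and3P[_ /hasPn/(_ b (mem_head _ _))].
have idxX q : uniq (joined q) -> index b (joined q) = size (rev (a :: q.1)).
  by move=> /bX/negbTE bq; rewrite /joined index_cat bq /= eqxx addn0.
move=> e; have sz : size (rev (a :: s)) = size (rev (a :: s')).
  by rewrite -[LHS](idxX (s, t)) // -[RHS](idxX (s', t')) // e.
move/eqP: e; rewrite /joined /= eqseq_cat // => /andP[/eqP/(can_inj revK)[->]].
by move=> /eqP[->].
Qed.

(** A crossing that contains the step from [a] to [b] splits there.  Its end
    steps are horizontal since its interior lies in the box. *)
Lemma spine_surj eta : pathW n eta -> infix [:: vtx a; vtx b] eta ->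
  exists2 p, p \in pairs D01 & eta = spine p.
Proof.
move=> /andP[eK ue] /infixP[p1 [p2 eE]].
have [l [e [r lr]]] := pathKP eK; rewrite lr in eK ue eE *.
move: eK; rewrite pathK_exit_path => /and3P[pe /eqP ln /eqP rn].
have : uniq e.
  move: ue; rewrite /= /exit_path rcons_uniq => /and3P[_ _].
  by rewrite (map_inj_uniq (@vtx_inj n)).
have [e1 [e2 eab]] : exists e1 e2, e = rev e1 ++ a :: b :: e2.
  case: p1 eE => [[la _]|x p1 [_]]; first by have := out_left ln; rewrite la box_vtx.
  case/lastP: p2 => [|p2 y].
    rewrite /exit_path -[RHS]cat_rcons cats1 => /rcons_inj[_ rb].
    by have := out_right rn; rewrite rb box_vtx.
  rewrite -!rcons_cons -rcons_cat => /rcons_inj[eE _].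
  exists (rev (take (size p1) e)), (drop (size p1).+2 e).
  rewrite revK -[LHS](cat_take_drop (size p1)); congr (_ ++ _).
  have sE := congr1 (drop (size p1)) eE; rewrite drop_size_cat // -map_drop in sE.
  case dE: (drop (size p1) e) sE => [//|a' [//|b' d]] /=.
  move=> [/vtx_inj -> /vtx_inj -> _]; do 2!congr cons.
  by rewrite -[(size p1).+2]/(2 + size p1)%N -drop_drop dE /= drop0.
have ej : e = joined (e1, e2) by rewrite eab /joined /= rev_cons cat_rcons.
rewrite ej uniq_joined => pD; exists (e1, e2) => //.
have a1 : adj l (vtx (last a e1)).
  move: pe; rewrite ej /joined /exit_path map_cat rcons_cat cat_path => /andP[+ _].
  rewrite -[path _ _ _]/(sorted adj (l :: map (@vtx n) (rev (a :: e1)))).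
  rewrite -sorted_rev_adj rev_cons map_rev revK /= rcons_path last_map adjC.
  by case/andP.
have a2 : adj (vtx (last b e2)) r.
  move: pe; rewrite ej /joined /exit_path rcons_path => /andP[_].
  by rewrite map_cat last_cat /= last_map.
by rewrite /spine -ej -(exit_adjL ln a1).2 -(exit_adjR rn a2).2.
Qed.

Lemma phat_spine p : p \in pairs D01 -> joined_path p ->
  phat R n (spine p) = (4^-1 * (exL (last a p.1) * path_weight P a p.1) *
    (exR (last b p.2) * path_weight P b p.2) *
    (lap_det P (avoid D01 (p.1 ++ p.2)) / lap_det P [set: I]%SET))%:E.
Proof.
move=> pD pp; rewrite phat_eq ?uniq_joined //; last by rewrite -[_ :: _]/(spine p) pathK_spine.
rewrite avoid_joined; congr EFin; congr (_ * _).
rewrite /joined entry_weight_rev /= mxE adj_ab /exit_right; case/and4P: pp => _ -> _ _.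
ring.
Qed.

(** The pairs that do not form a crossing have weight zero, so the sum may
    range over all disjoint pairs. *)
Lemma sum_spine :
  \esum_(eta in [set eta | pathW n eta && infix [:: vtx a; vtx b] eta]) phat R n eta =
  (\sum_(p <- pairs D01) (4^-1 * (exL (last a p.1) * path_weight P a p.1) *
    (exR (last b p.2) * path_weight P b p.2) *
    (lap_det P (avoid D01 (p.1 ++ p.2)) / lap_det P [set: I]%SET)))%:E.
Proof.
rewrite -sumEFin -esum_uniq ?uniq_pairs //; last first.
  move=> p _; rewrite lee_fin !mulr_ge0 ?exit_left_ge0 ?exit_right_ge0 ?path_weight_ge0
    ?invr_ge0 //;
    try exact: walk_mx_ge0; by rewrite ltW // lap_det_gt0.
transitivity (\esum_(p in [set p | p \in pairs D01] `&` [set p | joined_path p]) phat R n (spine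
  p)).
  apply: reindex_esum; split.
  - move=> p [pD pp]; apply/andP; split; last exact: infix_spine.
    have {}pD : uniq (joined p) by rewrite uniq_joined.
    rewrite /pathW pathK_spine; apply/andP; split; first exact: pp.
    rewrite /spine cons_uniq.
    rewrite /exit_path rcons_uniq (map_inj_uniq (@vtx_inj n)) pD andbT.
    case/and4P: (pp) => /eqP l1 /eqP r1 _ _.
    have lo : ~~ box n (west (vtx (last a p.1))) by apply: out_left; rewrite /west /Re /=;
      move: l1; rewrite /Re; lia.
    have ro : ~~ box n (east (vtx (last b p.2))) by apply: out_right; rewrite /east /Re /=;
      move: r1; rewrite /Re; lia.
    rewrite mem_rcons inE negb_or; apply/andP; split; first (apply/andP; split).
    + by apply/eqP => -[+ _]; move: l1 r1; rewrite /Re; lia.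
    + by apply/mapP => -[i _ ii]; move: lo; rewrite ii box_vtx.
    + by apply/mapP => -[i _ ii]; move: ro; rewrite ii box_vtx.
  - by move=> p q /set_mem[pD _] /set_mem[qD _]; exact: spine_inj.
  - move=> eta /= /andP[eW ei]; have [p pD pE] := spine_surj eW ei.
    exists p; rewrite ?pE //; split=> //=.
    by rewrite -pathK_spine -pE; case/andP: eW.
rewrite esum_mkcondr; apply: eq_esum => p pD.
case: ifPn => [/set_mem pp|/negP pp]; first by rewrite phat_spine.
apply/esym; congr EFin; apply/eqP; rewrite !mulf_eq0.
have {}pp : ~~ joined_path p by apply/negP => h; apply: pp; rewrite inE.
rewrite !path_weight_walk /exit_left /exit_right; move: pp; rewrite /joined_path.
by do 4!case: ifP => _ //=; rewrite ?eqxx ?orbT.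
Qed.

End Joined.

End PathSums.

(** * Rooted and unrooted loops *)
Lemma loop_shape (r : rooted_loop) :
  behead r != [::] /\ (r : seq Z2) = last pt0 (behead r) :: behead r.
Proof.
case: r => -[|x [|y p]] //=; rewrite /is_loop => /and4P[_ /eqP xp _ _] //.
by split=> //; rewrite /start /finish /= in xp; rewrite -xp.
Qed.

Lemma loop_stepsE (r : rooted_loop) : steps r = size (behead r).
Proof. by rewrite /steps size_behead. Qed.

Lemma loop_allE (V : pred Z2) (r : rooted_loop) : all V r = all V (behead r).
Proof.
have [b0 e] := loop_shape r; rewrite e /=.
apply: andb_idl => /allP; apply.
by case: (behead r) b0 => //= y p _; rewrite mem_last.
Qed.

(** The parity of a closed path does not depend on its root. *)
Lemma parity_rot (f : rel Z2) z j p :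
  parity f (last z (rot j p)) (rot j p) = parity f (last z p) p.
Proof.
rewrite -[in RHS](cat_take_drop j p) /rot; move: (take j p) (drop j p) => u v.
case: u => [|x u]; first by rewrite cats0.
case: v => [|y v]; first by rewrite cats0.
by rewrite !parity_cat !last_cat /= addbC.
Qed.

Section Invariance.
Variables (r r' : rooted_loop).
Hypothesis rr : loop_equiv r r'.

Lemma equiv_steps : steps r' = steps r.
Proof.
by have /loop_equivP[j _ e] := rr; rewrite !loop_stepsE e size_rot.
Qed.

Lemma equiv_all V : all V r' = all V r.
Proof.
have /loop_equivP[j _ e] := rr; rewrite !loop_allE e.
by apply: eq_all_r; exact: mem_rot.
Qed.

Lemma equiv_crossings : odd (crossings r') = odd (crossings r).
Proof.
have /loop_equivP[j _ e] := rr.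
have [_ ->] := loop_shape r; have [_ ->] := loop_shape r'.
by rewrite !odd_crossingsE e parity_rot.
Qed.

End Invariance.

Lemma pi_repr (r : rooted_loop) : loop_equiv r (repr (\pi_unrooted_loop r)%qT).
Proof. by apply/eqmodP; rewrite reprK. Qed.

Lemma pi_steps (r : rooted_loop) : loop_steps (\pi_unrooted_loop r)%qT = steps r.
Proof. exact: equiv_steps (pi_repr r). Qed.

Lemma pi_sub A (r : rooted_loop) : loop_sub A (\pi_unrooted_loop r)%qT = all A r.
Proof. exact: equiv_all (pi_repr r) A. Qed.

Lemma pi_crossings (r : rooted_loop) :
  odd (loop_crossings (\pi_unrooted_loop r)%qT) = odd (crossings r).
Proof. exact: equiv_crossings (pi_repr r). Qed.

Lemma finite_loop_class (l : unrooted_loop) :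
  finite_set [set r : rooted_loop | (\pi_unrooted_loop r)%qT = l].
Proof.
rewrite -(reprK l); set r0 := repr l.
pose rs := [seq reroot j r0 | j <- iota 0 (steps r0).+1].
pose cl : seq rooted_loop := pmap insub rs.
apply: (@sub_finite_set _ _ [set` cl]) => //.
move=> r /= /esym/eqmodP rr; have /hasP[j jr /eqP rE] : loop_equiv r0 r by exact: rr.
have : r \in cl by rewrite mem_pmap_sub; apply/mapP; exists j.
by [].
Qed.

(** The multiplicity [d] in the loop measure counts the roots, so the measure
    of a set of unrooted loops spreads evenly over the rooted ones. *)
Lemma esum_rooted (R : realType) (S : set unrooted_loop) :
  \esum_(l in S) (loop_weight R l)%:E =
  \esum_(r in [set r : rooted_loop | S (\pi_unrooted_loop r)%qT])
    (4^-1 ^+ steps r / (steps r)%:R)%:E.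
Proof.
pose J (l : unrooted_loop) := [set r : rooted_loop | (\pi_unrooted_loop r)%qT = l].
pose w (r : rooted_loop) : R := 4^-1 ^+ steps r / (steps r)%:R.
have w0 r : 0 <= w r by rewrite /w divr_ge0 // exprn_ge0.
transitivity (\esum_(l in S) \esum_(r in J l) (w r)%:E).
  apply: eq_esum => l _; rewrite esum_fset ?fsbig_finite; try exact: finite_loop_class.
    rewrite sumEFin; congr EFin; rewrite /loop_weight /loop_mult -/(J l).
    transitivity (\sum_(r <- fset_set (J l)) (4^-1 ^+ loop_steps l / (loop_steps l)%:R) : R).
      by rewrite big_const_seq count_predT iter_addr_0 -[RHS]mulr_natr mulrAC.
    apply: eq_big_seq => r; rewrite in_fset_set; last exact: finite_loop_class.
    by rewrite inE /J /= => <-; rewrite /w pi_steps.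
  by move=> r _; rewrite lee_fin.
rewrite (@esum_esum _ _ _ S J (fun _ r => (w r)%:E)); last by move=> *; rewrite lee_fin.
rewrite (reindex_esum [set r : rooted_loop | S (\pi_unrooted_loop r)%qT] (S `*`` J)
  (fun r => ((\pi_unrooted_loop r)%qT, r))) //.
split.
- by move=> r /= rS; split.
- by move=> r r' _ _ [].
- by move=> [l r] [/= lS rl]; exists r; rewrite /= ?rl //.
Qed.

(** * Loop sums as logarithms of determinants *)
(** The square lattice is bipartite. *)
Lemma closed_path_even x s : path adj x s -> last x s = x -> ~~ odd (size s).
Proof.
pose par (z : Z2) := odd (absz (z.1 + z.2)%R).
have flip : forall y z, adj y z -> true = par y (+) par z.
  apply: adj_ind => [y z|c d|c d]; first by rewrite addbC.
    rewrite /par /=; lia.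
  rewrite /par /=; lia.
move=> xs closed.
have <- : parity (fun _ _ => true) x s = odd (size s).
  by elim: s x {xs closed} => //= y s IH x; rewrite IH.
by rewrite (eq_parity_in flip xs) parity_boundary closed addbb.
Qed.

(** A trace sums over closed walks.  The walk is recorded without its root,
    which is its last vertex; [x0] only matters for the empty sequence. *)
Lemma tr_tuple (R : realType) N (M : 'M[R]_N) (D : {set 'I_N}) x0 k :
  \sum_(t : k.+1.-tuple 'I_N | all (mem D) t) path_weight M (last x0 t) t =
  \tr (killed M D ^+ k.+1).
Proof.
rewrite tr_pow // /walk_sum exchange_big; apply: eq_bigr => t tD /=.
have lt : last x0 t \in D.
  apply: (allP tD); case: t {tD} => -[|y t] //= _; exact: mem_last.
have lE x : last x t = last x0 t by case: t {tD lt} => -[|y t].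
rewrite (bigD1 (last x0 t)) //= (lE (last x0 t)) eqxx mulr1 big1 ?addr0 // => x /andP[_ xl].
by rewrite (lE x) eq_sym (negbTE xl) mulr0.
Qed.

Section LoopSums.
Variables (n : nat) (n_gt0 : (0 < n)%N) (R : realType).
Local Notation I := 'I_(box_size n).
Local Notation P := (walk_mx n R).
Local Notation Q := (signed_mx n R).
Local Notation vtx_idx := (vtx_idx n_gt0).
Local Notation i0 := (vtx_idx pt0).
Let Psub := walk_mx_subcritical n R.
Let Psym := walk_mx_sym n R.
Let Qsub := signed_mx_subcritical n R.
Let Qsym := signed_mx_sym n R.

Lemma path_weight_signed x s :
  path_weight Q x s = sgn_of R (parity crosses (vtx x) (map (@vtx n) s)) * path_weight P x s.
Proof.
elim: s x => [|y s IH] x /=; first by rewrite mulr1.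
rewrite IH signed_mxE mxE /sgn_of; case: ifP => _; last by rewrite !mul0r mulr0.
by case: (crosses _ _); case: (parity _ _ _) => /=; ring.
Qed.

Variable D : {set I}.

Definition inside : pred Z2 := fun z => box n z && (vtx_idx z \in D).

Lemma all_inside s : all inside (map (@vtx n) s) = all (mem D) s.
Proof. by rewrite all_map; apply: eq_all => i; rewrite /inside /= box_vtx vtxK. Qed.

Lemma map_vtx_inside t : all inside t -> map (@vtx n) (map vtx_idx t) = t.
Proof. by move=> tI; rewrite -map_vtx_idx //; apply: sub_all tI => z /andP[]. Qed.

Variable b : bool.

(** The half-sum of the unsigned and the signed weights selects the loops with
    crossing parity [b].  The sequence [s] is the loop rooted at its last
    vertex; the empty sequence has term zero because [0^-1 = 0]. *)
Definition loop_term (s : seq I) : R :=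
  (path_weight P (last i0 s) s + sgn_of R b * path_weight Q (last i0 s) s) / 2 / (size s)%:R.

Lemma loop_termE s : s != [::] -> loop_term s =
  if path adj (vtx (last i0 s)) (map (@vtx n) s) &&
     (parity crosses (vtx (last i0 s)) (map (@vtx n) s) == b)
  then 4^-1 ^+ size s / (size s)%:R else 0.
Proof.
move=> s0; rewrite /loop_term path_weight_signed path_weight_walk.
case: ifP => _ /=; last by rewrite !mulr0 addr0 !mul0r.
have half (w : R) : (w + w) / 2 = w by field.
by rewrite /sgn_of; case: (parity _ _ _); case: b;
  rewrite /= ?mulN1r ?opprK ?mul1r ?half ?subrr ?mul0r.
Qed.

Lemma esum_rooted_seq :
  \esum_(r in [set r : rooted_loop | all inside r && (odd (crossings r) == b)])
    (4^-1 ^+ steps r / (steps r)%:R : R)%:E =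
  \esum_(s in [set s | all (mem D) s]) (loop_term s)%:E.
Proof.
pose G := [set s : seq I | [&& s != [::],
  path adj (vtx (last i0 s)) (map (@vtx n) s) &
  parity crosses (vtx (last i0 s)) (map (@vtx n) s) == b]].
transitivity (\esum_(s in [set s | all (mem D) s] `&` G) (4^-1 ^+ size s / (size s)%:R : R)%:E).
  apply/esym; rewrite (reindex_esum
    [set r : rooted_loop | all inside r && (odd (crossings r) == b)] _
    (fun r : rooted_loop => map vtx_idx (behead r))).
    by apply: eq_esum => r _; rewrite size_map loop_stepsE.
  have lastE (s : seq I) : s != [::] -> last pt0 (map (@vtx n) s) = vtx (last i0 s).
    by case: s => //= i s _; rewrite last_map.
  split.
  - move=> r /= /andP[rI rb]; have [r0 rE] := loop_shape r.
    move: rI; rewrite loop_allE => rI.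
    have m0 : map vtx_idx (behead r) != [::] by case: (behead r) r0.
    split=> /=; first by rewrite -all_inside map_vtx_inside.
    apply/and3P; rewrite -lastE // map_vtx_inside // -odd_crossingsE -rE; split=> //.
    case: (r) rE => l lP /= lE; case/and4P: (lP) => /andP[_].
    by rewrite {1}lE.
  - move=> r r' /set_mem/= /andP[rI _] /set_mem/= /andP[rI' _] e.
    move: rI rI'; rewrite !loop_allE => rI rI'.
    apply: val_inj => /=; have [_ ->] := loop_shape r; have [_ ->] := loop_shape r'.
    by rewrite -(map_vtx_inside rI) -(map_vtx_inside rI') e.
  - move=> s [/= sD /and3P[s0 sp sb]].
    have lP : is_loop (vtx (last i0 s) :: map (@vtx n) s).
      have cl : last (vtx (last i0 s)) (map (@vtx n) s) = vtx (last i0 s).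
        by rewrite last_map; case: (s) s0.
      rewrite /is_loop /nnpath /= sp /start /finish /= cl eqxx /=.
      by rewrite /steps /= (closed_path_even sp cl) size_map lt0n size_eq0.
    exists (RootedLoop lP) => /=; last by rewrite -map_comp map_id_in // => i _ /=; rewrite vtxK.
    rewrite odd_crossingsE sb andbT all_inside sD andbT.
    rewrite /inside box_vtx vtxK; apply: (allP sD).
    by case: (s) s0 => //= i s' _; exact: mem_last.
rewrite esum_mkcondr; apply: eq_esum => s sD.
have [->|s0] := eqVneq s [::].
  by rewrite /loop_term /= invr0 !mulr0; case: ifP.
rewrite loop_termE //; case: ifPn => [/set_mem /and3P[_ -> ->] //|/negP h].
by case: ifP => // c; case: h; rewrite inE /G /= s0.
Qed.

Lemma esum_loop_term :
  \esum_(s in [set s | all (mem D) s]) (loop_term s)%:E =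
  (2^-1 * (- ln (lap_det P D) + sgn_of R b * - ln (lap_det Q D)))%:E.
Proof.
have term0 s : 0 <= loop_term s.
  have [->|s0] := eqVneq s [::]; first by rewrite /loop_term /= invr0 mulr0.
  by rewrite loop_termE //; case: ifP => // _; rewrite divr_ge0 // exprn_ge0.
rewrite (@esum_size _ _ (all (mem D)) (fun s => (loop_term s)%:E)); last first.
  by move=> s; rewrite lee_fin.
pose u k : R := \sum_(t : k.-tuple I | all (mem D) t) loop_term t.
transitivity (\sum_(k <oo) (u k)%:E)%E.
  by apply: eq_eseriesr => k _; rewrite sumEFin.
apply: nneseries_cvg => [k|]; first by rewrite sumr_ge0.
rewrite -(cvg_shiftS (fun m => \sum_(k < m) u k)) /=.
rewrite (_ : (fun m => _) = (fun m => 2^-1 *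
   (\sum_(k < m) \tr (killed P D ^+ k.+1) / k.+1%:R +
    sgn_of R b * \sum_(k < m) \tr (killed Q D ^+ k.+1) / k.+1%:R))).
  by apply: cvgMr; apply: cvgD; last apply: cvgMr; exact: cvg_ln_lap_det.
apply/funext => m; rewrite big_ord_recl {1}/u big1 ?add0r; last first.
  by move=> t _; rewrite tuple0 /loop_term /= invr0 mulr0.
rewrite mulr_sumr -big_split /= mulr_sumr; apply: eq_bigr => k _.
rewrite /bump /= add1n /u -!(tr_tuple _ _ i0) !mulr_suml mulr_sumr -big_split mulr_sumr.
apply: eq_bigr => t _ /=; rewrite /loop_term size_tuple; ring.
Qed.

(** Rooted loops carry the weight [4 ^- k / k], so summing [loop_term] over
    lengths gives the logarithmic series of the two determinants. *)
Lemma loops_sum :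
  \esum_(l in [set l | loop_sub inside l && (odd (loop_crossings l) == b)])
     (loop_weight R l)%:E =
  (2^-1 * (- ln (lap_det P D) + sgn_of R b * - ln (lap_det Q D)))%:E.
Proof.
rewrite esum_rooted -esum_loop_term -esum_rooted_seq.
congr esum; apply/seteqP; split=> r /=; by rewrite pi_sub pi_crossings.
Qed.

End LoopSums.

(** * The signed sum over self-avoiding paths *)
Lemma parity_rev (T : Type) (f : rel T) z x s : (forall y y', f y y' = f y' y) ->
  parity f z (rev (x :: s)) = parity f x (rcons s z).
Proof.
move=> fC; elim: s x => [|y s IH] x; first by rewrite /= fC.
rewrite rev_cons -cats1 parity_cat IH rev_cons last_rcons /= addbF addbC.
by rewrite fC.
Qed.

Lemma infix_index (T : eqType) (a b : T) s : uniq s -> infix [:: a; b] s ->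
  index b s = (index a s).+1.
Proof.
move=> us /infixP[p1 [p2 e]]; move: us; rewrite e cat_uniq /= => /and3P[_ d /andP[ab _]].
have ap : a \notin p1 by apply: contra d => ap; rewrite ap.
have bp : b \notin p1 by apply: contra d => bp; rewrite bp orbT.
move: ab; rewrite inE negb_or => /andP[/negbTE ab _].
by rewrite !index_cat (negbTE ap) (negbTE bp) /= !eqxx ab addn0 addn1.
Qed.

Section Final.
Variables (n : nat) (n_gt0 : (0 < n)%N) (R : realType).
Local Notation I := 'I_(box_size n).
Local Notation P := (walk_mx n R).
Local Notation Q := (signed_mx n R).
Local Notation vtx_idx := (vtx_idx n_gt0).
Local Notation i0 := (vtx_idx pt0).
Local Notation i1 := (vtx_idx pt1).
Local Notation exL := (@exit_left n R).
Local Notation exR := (@exit_right n R).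
Local Notation exit_path := (@exit_path n).
Local Notation D01 := (off01 n).
Local Notation A := [set: I]%SET.
Let Psub := walk_mx_subcritical n R.
Let Psym := walk_mx_sym n R.
Let Qsub := signed_mx_subcritical n R.
Let Qsym := signed_mx_sym n R.
Let walk_det_gt0 D : 0 < lap_det P D := lap_det_gt0 Psub Psym D.
Let signed_det_gt0 D : 0 < lap_det Q D := lap_det_gt0 Qsub Qsym D.

(** The closed walks in [D] avoid a path from the left side to [0], hence
    cross the zipper evenly: all traces agree, and so do the determinants. *)
Lemma lap_det_signed l p (D : {set I}) : Re l = - n%:Z -> path adj l p -> pt0 \in l :: p ->
  (forall i, i \in D -> vtx i \notin l :: p) -> lap_det P D = lap_det Q D.
Proof.
move=> lN lp p0 Dout.
have trE k : \tr (killed P D ^+ k.+1) = \tr (killed Q D ^+ k.+1).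
  rewrite -!(tr_tuple _ _ i0); apply: eq_bigr => t tD; rewrite path_weight_signed path_weight_walk.
  case: ifP => [pth|_]; last by rewrite mulr0.
  have tn : tval t != [::] by case: (t) => -[].
  have lD : last i0 t \in D.
    by apply: (allP tD); case: (tval t) tn => //= i s _; exact: mem_last.
  rewrite (loop_even (n := n) pth _ _ lN lp) ?mul1r //.
  - by rewrite last_map; case: (tval t) tn.
  - by rewrite /= box_vtx all_box_vtx.
  - move=> v vp; apply/negP; rewrite -[_ :: _]/(map (@vtx n) (last i0 t :: t)) => /mapP[i it vi].
    suff : i \in D by move/Dout; rewrite -vi vp.
    by move: it; rewrite inE => /predU1P[->//|]; exact: (allP tD).
have lnE : - ln (lap_det P D) = - ln (lap_det Q D).
  have cP := cvg_ln_lap_det (D := D) Psub Psym; have cQ := cvg_ln_lap_det (D := D) Qsub Qsym.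
  have e : (fun m => \sum_(k < m) \tr (killed P D ^+ k.+1) / k.+1%:R) =
    (fun m => \sum_(k < m) \tr (killed Q D ^+ k.+1) / k.+1%:R).
    by apply/funext => m; apply: eq_bigr => k _; rewrite trE.
  rewrite e in cP; apply: (cvg_unique _ cP cQ) => //.
have := congr1 (@expR R) (oppr_inj lnE).
by rewrite (lnK (walk_det_gt0 D)) (lnK (signed_det_gt0 D)).
Qed.

Section Sign.
Variables a b : I.
Hypothesis ab : (a, b) = (i0, i1) \/ (a, b) = (i1, i0).

Let pt_ab : (vtx a, vtx b) = (pt0, pt1) \/ (vtx a, vtx b) = (pt1, pt0).
Proof. by case: ab => -[-> ->]; rewrite vtx_i0 vtx_i1; [left|right]. Qed.

(** The steps of the spine outside the two paths do not cross the zipper. *)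
Lemma spine_crossing p : p \in pairs (off01 n) -> joined_path a b p ->
  parity crosses (vtx a) (map (@vtx n) p.1) (+) parity crosses (vtx b) (map (@vtx n) p.2) =
    (a == i1).
Proof.
move=> pD pp; have := pathK_spine ab p; rewrite pp.
rewrite /spine pathK_exit_path; set l := west _; set r := east _ => /and3P[pth /eqP ln /eqP rn].
have uj : uniq (joined a b p) by rewrite uniq_joined.
have us : uniq (l :: exit_path r (joined a b p)).
  rewrite /= /exit_path rcons_uniq (map_inj_uniq (@vtx_inj n)) uj andbT mem_rcons inE negb_or.
  apply/andP; split; first (apply/andP; split).
  - by apply/eqP => lr; move: ln; rewrite lr rn; lia.
  - by apply/mapP => -[i _ li]; have := out_left ln; rewrite li box_vtx.
  - by apply/mapP => -[i _ ri]; have := out_right rn; rewrite ri box_vtx.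
have cl x : crosses l x = false.
  by rewrite /crosses ln; apply/negP => /and3P[_ _]; lia.
have cr x : crosses x r = false.
  by rewrite /crosses rn; apply/negP => /and3P[_ _]; lia.
have cab : crosses (vtx a) (vtx b) = false.
  by case: pt_ab => -[-> ->].
have E : exit_path r (joined a b p) = (map (@vtx n) (rev p.1) ++ [:: vtx a]) ++ vtx b ::
  exit_path r p.2.
  by rewrite /exit_path /joined rev_cons map_cat rcons_cat map_rcons cats1.
have <- : parity crosses l (exit_path r (joined a b p)) =
  parity crosses (vtx a) (map (@vtx n) p.1) (+) parity crosses (vtx b) (map (@vtx n) p.2).
  rewrite E cats1 -map_rcons -rev_cons map_rev parity_cat.
  rewrite parity_rev; last exact: crossesC.
  rewrite rev_cons last_rcons -cats1 parity_cat /= crossesC cl /exit_path -cats1 parity_cat /=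
    cab cr.
  by rewrite !addbF.
have [eab|eab] := pt_ab; case: eab => ea eb.
- have -> : (a == i1) = false.
    by apply/negbTE; rewrite -(inj_eq (@vtx_inj n)) ea vtx_i1.
  move: E; rewrite eb /exit_path => E.
  rewrite /exit_path; apply: (crossing_parity01 n_gt0 ln rn _ pth us E).
    exact: all_box_vtx.
  by rewrite last_cat.
- have -> : (a == i1) by rewrite -(inj_eq (@vtx_inj n)) ea vtx_i1.
  move: E; rewrite eb /exit_path => E.
  rewrite /exit_path; apply: (crossing_parity10 n_gt0 ln rn _ pth us E).
    exact: all_box_vtx.
  by rewrite last_cat.
Qed.

(** For a crossing, both the loops around it and its own steps may be
    weighted with [Q], up to the sign that records the direction in which the
    edge [01] is used. *)
Lemma signed_term p : p \in pairs (off01 n) ->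
  (exL (last a p.1) * path_weight P a p.1) * (exR (last b p.2) * path_weight P b p.2) *
    lap_det P (avoid D01 (p.1 ++ p.2)) =
  sgn_of R (a == i1) * ((exL (last a p.1) * path_weight Q a p.1) *
    (exR (last b p.2) * path_weight Q b p.2) * lap_det Q (avoid D01 (p.1 ++ p.2))).
Proof.
move=> pD; rewrite !path_weight_signed.
case: (boolP (joined_path a b p)) => [pp|pp].
  have sg := spine_crossing pD pp.
  have -> : lap_det P (avoid D01 (p.1 ++ p.2)) = lap_det Q (avoid D01 (p.1 ++ p.2)).
    rewrite -(avoid_joined ab); have := pathK_spine ab p; rewrite pp.
    rewrite /spine pathK_exit_path => /and3P[pth /eqP ln /eqP rn].
    apply: (lap_det_signed ln pth).
      have : i0 \in joined a b p.
        rewrite /joined mem_cat mem_rev !inE.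
        by case: ab => -[-> ->]; rewrite eqxx ?orbT.
      move=> /(map_f (@vtx n)); rewrite vtx_i0 => h.
      by rewrite inE /exit_path mem_rcons inE h !orbT.
    move=> i; rewrite inE => /andP[_ ij]; rewrite inE /exit_path mem_rcons inE !negb_or.
    rewrite (mem_map (@vtx_inj n)) ij andbT; apply/andP; split.
      by apply/eqP => e; have := out_left ln; rewrite -e box_vtx.
    by apply/eqP => e; have := out_right rn; rewrite -e box_vtx.
  rewrite -sg /sgn_of; case: (parity _ _ _); case: (parity _ _ _) => /=; ring.
have : (exL (last a p.1) * path_weight P a p.1) * (exR (last b p.2) * path_weight P b p.2) = 0.
  apply/eqP; rewrite !mulf_eq0 !path_weight_walk /exit_left /exit_right; move: pp;
    rewrite /joined_path.
  by do 4!case: ifP => _ //=; rewrite ?eqxx ?orbT.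
set u := exL _; set v := exR _; set x := path_weight P a _; set y := path_weight P b _.
set s := sgn_of R _; set s1 := sgn_of R _; set s2 := sgn_of R _ => z.
transitivity (s * s1 * s2 * (u * x * (v * y)) * lap_det Q (avoid D01 (p.1 ++ p.2))).
  by rewrite z mulr0 !mul0r.
ring.
Qed.

End Sign.

Lemma sum_pairs (F : seq I -> seq I -> R) D :
  \sum_(p <- pairs D) F p.1 p.2 = \sum_(s <- uniq_seqs D) \sum_(t <- uniq_seqs (avoid D s)) F s t.
Proof. by rewrite /pairs big_allpairs_dep. Qed.

Lemma sum_pairs_swap (F : seq I * seq I -> R) D :
  \sum_(p <- pairs D) F p = \sum_(p <- pairs D) F (p.2, p.1).
Proof.
rewrite -(big_map (fun p => (p.2, p.1)) xpredT F); apply: perm_big.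
have swI : injective (fun p : seq I * seq I => (p.2, p.1)).
  by move=> [s t] [s' t'] /= [-> ->].
apply: uniq_perm; rewrite ?map_inj_uniq ?uniq_pairs // => -[s t].
apply/idP/mapP => [h|[[s' t'] h [-> ->]]].
  exists (t, s) => //; move: h; rewrite !mem_pairs /= uniq_catC.
  by rewrite !all_cat andbC [X in X && _]andbC andbC.
move: h; rewrite !mem_pairs /= uniq_catC.
by rewrite !all_cat andbC [X in X && _]andbC andbC.
Qed.

(** A crossing uses the edge [01] in exactly one direction.  With the paths
    listed as the one from [0] and the one from [1], the two directions are
    the two terms of the antisymmetrised sum in [fomin]. *)
Lemma sum_Wstar :
  \esum_(eta in [set eta | pathWstar n eta]) phat R n eta =
  (4^-1 * (lap_det Q D01 / lap_det P A) * (exit_sum P (slit n) exL i0) ^+ 2)%:E.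
Proof.
have ph0 eta : (0 <= phat R n eta)%E.
  by apply: esum_ge0 => w _; rewrite lee_fin exprn_ge0.
rewrite (esumID [set eta | infix [:: pt0; pt1] eta]) //.
have -> : [set eta | pathWstar n eta] `&` [set eta | infix [:: pt0; pt1] eta] =
    [set eta | pathW n eta && infix [:: vtx i0; vtx i1] eta].
  apply/seteqP; split=> eta; rewrite vtx_i0 vtx_i1 /pathWstar.
    by move=> [/andP[h _] h']; apply/andP.
  by move=> /andP[h h']; split => //; apply/andP; split=> //; apply/orP; left.
have -> : [set eta | pathWstar n eta] `&` ~` [set eta | infix [:: pt0; pt1] eta] =
    [set eta | pathW n eta && infix [:: vtx i1; vtx i0] eta].
  apply/seteqP; split=> eta; rewrite vtx_i0 vtx_i1 /pathWstar.
    by move=> [/andP[h /orP[h'|h']] h'']; [case: h''|apply/andP].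
  move=> /andP[h h']; split; first by apply/andP; split=> //; apply/orP; right.
  move=> h''; case/andP: h => _ ue.
  have := infix_index ue h''; rewrite (infix_index ue h'); lia.
rewrite !sum_spine; try by [left|right].
rewrite -EFinD; congr EFin.
pose F a b (p : seq I * seq I) := (exL (last a p.1) * path_weight Q a p.1) *
    (exR (last b p.2) * path_weight Q b p.2) * lap_det Q (avoid D01 (p.1 ++ p.2)).
have S a b : (a, b) = (i0, i1) \/ (a, b) = (i1, i0) ->
  \sum_(p <- pairs D01) (4^-1 * (exL (last a p.1) * path_weight P a p.1) *
    (exR (last b p.2) * path_weight P b p.2) * (lap_det P (avoid D01 (p.1 ++ p.2)) / lap_det P A)) =
  4^-1 / lap_det P A * (sgn_of R (a == i1) * \sum_(p <- pairs D01) F a b p).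
  move=> ab; rewrite !mulr_sumr; apply: eq_big_seq => p pD.
  rewrite /F -(signed_term ab pD); ring.
rewrite (S i0 i1) ?(S i1 i0); try by [left|right].
rewrite eqxx -(inj_eq (@vtx_inj n)) vtx_i0 vtx_i1 /=.
rewrite [\sum_(p <- _) F i1 i0 p]sum_pairs_swap.
have := fomin (lap_det_neq0 Qsub Qsym) D01 i0 i1 exL exR.
rewrite exit_sum_right0 exit_sum_left1 exit_sum_right1 exit_sum_left0 mulr0 subr0 -expr2.
rewrite -(sum_pairs (fun s t => path_weight Q i0 s * path_weight Q i1 t *
   (exL (last i0 s) * exR (last i1 t) - exR (last i0 s) * exL (last i1 t)) *
     lap_det Q (avoid (avoid D01 s) t))) => fom.
have -> : \sum_(p <- pairs D01) F i0 i1 p = lap_det Q D01 * exit_sum P (slit n) exL i0 ^+ 2 +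
    \sum_(p <- pairs D01) F i1 i0 (p.2, p.1).
  rewrite -fom -big_split; apply: eq_big_seq => p pD; rewrite /F /=.
  have -> : avoid D01 (p.2 ++ p.1) = avoid D01 (p.1 ++ p.2).
    by apply/setP => i; rewrite !inE !mem_cat orbC.
  rewrite avoid_cat; ring.
rewrite /sgn_of; ring.
Qed.

End Final.

(** * Loop measures and the identity *)
Section LoopFactors.
Variables (n : nat) (n_gt0 : (0 < n)%N) (R : realType).
Local Notation I := 'I_(box_size n).
Local Notation P := (walk_mx n R).
Local Notation Q := (signed_mx n R).
Local Notation D01 := (off01 n).
Local Notation A := [set: I]%SET.

(** The loop measure of the loops in [D] with crossing parity [b]. *)
Definition half_mass (D : {set I}) (b : bool) : R :=
  2^-1 * (- ln (lap_det P D) + sgn_of R b * - ln (lap_det Q D)).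

Lemma loop_weight_ge0 l : 0 <= loop_weight R l.
Proof. by rewrite /loop_weight mulr_ge0 ?invr_ge0 // mulr_ge0 // exprn_ge0. Qed.

Lemma inside_setT : inside n_gt0 A = box n.
Proof. by apply/funext => z; rewrite /inside inE andbT. Qed.

Lemma inside_off01 z : inside n_gt0 D01 z = box n z && ~~ pred2 pt0 pt1 z.
Proof.
rewrite /inside inE; case: (boolP (box n z)) => //= bz.
by rewrite vtx_idxK // negb_or.
Qed.

Lemma measure_oddJ : loop_measure R (oddJ (box n)) = (half_mass A true)%:E.
Proof.
rewrite /half_mass -loops_sum inside_setT; congr esum; apply/seteqP; split=> l.
  by move=> [h1 h2]; rewrite /= h1 h2.
by move=> /andP[h1 /eqP h2].
Qed.

(** The loops that meet [{0, 1}] are those of the box that are not contained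
    in its complement. *)
Lemma sum_loops01 (b : bool) :
  \esum_(l in [set l | loops01 (box n) l /\ odd (loop_crossings l) = b])
    (loop_weight R l)%:E = (half_mass A b - half_mass D01 b)%:E.
Proof.
have w0 (l : unrooted_loop) : (0 <= (loop_weight R l)%:E)%E.
  by rewrite lee_fin loop_weight_ge0.
have := loops_sum n_gt0 R A b; rewrite -/(half_mass A b) inside_setT.
rewrite (esumID [set l | loop_meets (pred2 pt0 pt1) l]) //.
rewrite (_ : _ `&` ~` _ = [set l | loop_sub (inside n_gt0 D01) l && (odd (loop_crossings l) == b)]).
  rewrite loops_sum -/(half_mass D01 b) EFinB => <-; rewrite addeK //.
  congr esum; apply/seteqP; split=> l /=.
    by move=> [[h1 h2] ->]; rewrite h1 eqxx.
  by move=> [/andP[h1 /eqP h2] h3].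
apply/seteqP; split=> l /=.
  move=> [/andP[h1 ->] /negP h2]; rewrite andbT; apply/allP => z zl.
  rewrite inside_off01 [box n z](allP h1) //=; apply: contra h2 => hz.
  by apply/hasP; exists z.
move=> /andP[/allP h ->]; rewrite andbT; split.
  by apply/allP => z /h; rewrite inside_off01 => /andP[].
by move=> /hasP[z /h]; rewrite inside_off01 => /andP[_ /negbTE->].
Qed.

Lemma signed_esum_loops01 :
  signed_esum (loops01 (box n)) (@signed_loop_weight R) =
  (ln (lap_det Q D01) - ln (lap_det Q A))%:E.
Proof.
have pos : \esum_(l in loops01 (box n)) (@signed_loop_weight R)^\+%E l =
    (half_mass A false - half_mass D01 false)%:E.
  rewrite -sum_loops01 (_ : [set l | _] = loops01 (box n) `&` [set l | ~~ odd (loop_crossings l)]).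
    rewrite [RHS]esum_mkcondr; apply: eq_esum => l _.
    rewrite funeposE /signed_loop_weight -signr_odd.
    case: ifPn => [|/negP]; rewrite inE /= => h.
      by rewrite (negbTE h) expr0 mulr1; apply/max_idPl; rewrite lee_fin loop_weight_ge0.
    have -> : odd (loop_crossings l) by apply: contrapT => /negP.
    by rewrite expr1 mulrN1; apply/max_idPr; rewrite lee_fin oppr_le0 loop_weight_ge0.
  by apply/seteqP; split=> l /= [h1 h2]; split=> //; [rewrite h2|exact/negbTE].
have neg : \esum_(l in loops01 (box n)) (@signed_loop_weight R)^\-%E l =
    (half_mass A true - half_mass D01 true)%:E.
  rewrite -sum_loops01 (_ : [set l | _] = loops01 (box n) `&` [set l | odd (loop_crossings l)]).
    rewrite [RHS]esum_mkcondr; apply: eq_esum => l _.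
    rewrite funenegE /signed_loop_weight -signr_odd.
    case: ifPn => [|/negP]; rewrite inE /= => h.
      by rewrite h expr1 mulrN1 opprK; apply/max_idPl; rewrite lee_fin loop_weight_ge0.
    have -> : odd (loop_crossings l) = false by apply/negP.
    by rewrite expr0 mulr1; apply/max_idPr; rewrite lee_fin oppr_le0 loop_weight_ge0.
  by apply/seteqP; split=> l /= [h1 h2]; split.
rewrite /signed_esum pos neg -EFinB; congr EFin.
rewrite /half_mass /sgn_of.
move: (ln (lap_det P A)) (ln (lap_det P D01)) (ln (lap_det Q A)) (ln (lap_det Q D01)) => p p' q q'.
lra.
Qed.

Lemma summable_loops01 : summable (loops01 (box n)) (@signed_loop_weight R).
Proof.
rewrite /summable.
have -> : \esum_(l in loops01 (box n)) `|@signed_loop_weight R l|%E =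
   \esum_(l in loops01 (box n)) (loop_weight R l)%:E.
  apply: eq_esum => l _; rewrite /signed_loop_weight /= normrM normrX normrN1 expr1n mulr1.
  by rewrite ger0_norm ?loop_weight_ge0.
rewrite (esumID [set l | odd (loop_crossings l) = true]); last first.
  by move=> l _; rewrite lee_fin loop_weight_ge0.
rewrite (_ : _ `&` ~` _ = [set l | loops01 (box n) l /\ odd (loop_crossings l) = false]).
  by rewrite -[_ `&` _]/([set l | loops01 (box n) l /\ odd (loop_crossings l) =
    true]) !sum_loops01 -EFinD ltry.
by apply/seteqP; split=> l /= [h1 h2]; split=> //; [exact/negbTE/negP|rewrite h2].
Qed.

End LoopFactors.

Local Open Scope ereal_scope.

Theorem theorem3p1 (R : realType) (n : nat) (n_gt0 : (0 < n)%N) :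
  [/\ Rn R n < +oo,
      loop_measure R (oddJ (box n)) < +oo,
      summable (loops01 (box n)) (@signed_loop_weight R)
    & (4%:E * (\esum_(eta in [set eta | pathWstar n eta]) phat R n eta)
      = Q01 R (box n) * Rn R n ^+ 2
        * expeR (2%:E * loop_measure R (oddJ (box n))))%E].
Proof.
have P0 D : (0 < lap_det (walk_mx n R) D)%R := lap_det_gt0 (walk_mx_subcritical n R)
  (walk_mx_sym n R) D.
have Q0 D : (0 < lap_det (signed_mx n R) D)%R := lap_det_gt0 (signed_mx_subcritical n R)
  (signed_mx_sym n R) D.
rewrite (Rn_eq n_gt0) (measure_oddJ n_gt0) (sum_Wstar n_gt0); split; rewrite ?ltry //.
  exact: summable_loops01.
rewrite /Q01 signed_esum_loops01 // /half_mass /sgn_of.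
rewrite -EFin_expe -!EFinM /=; congr EFin.
have half (p q : R) : (2 * (2^-1 * (- p + -1 * - q)) = q - p)%R by lra.
have exp_lnB (u v : R) : (0 < u -> 0 < v -> expR (ln u - ln v) = u / v)%R.
  by move=> u0 v0; rewrite expRD expRN (lnK u0) (lnK v0).
rewrite half (exp_lnB _ _ (Q0 _) (Q0 _)) (exp_lnB _ _ (Q0 _) (P0 _)).
have := lt0r_neq0 (P0 [set: 'I_(box_size n)]%SET);
  have := lt0r_neq0 (Q0 [set: 'I_(box_size n)]%SET).
move: (lap_det (signed_mx n R) (off01 n)) (exit_sum _ _ _ _) => d e.
move: (lap_det (signed_mx n R) _) (lap_det (walk_mx n R) _) => q p q0 p0.
by field; rewrite p0 q0.
Qed.
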